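(* Let $k$ be an algebraically closed field containing $\mathbb{F}_3$ and let $a\in k$ with $a^2\notin\mathbb{F}_3$. Put $Q_{1,a}:=X^4-(a^4+a^2-1)X^2+1$ and $Q_{2,a}:=a\big(X^4+(a^4-a^2-1)X^2+a^8\big)$. Then the pair $(Q_{1,a},Q_{2,a})$ is a prompt for a space $L_{12,2}$, denoted $\Omega_a$. Conversely, if $\Omega$ is any space $L_{12,2}$ of meromorphic differential forms on $\mathbb{P}^1_k$, then there exists $a\in k$ with $a^2\notin\mathbb{F}_3$ such that $\Omega$ is equivalent to $\Omega_a$.
   Context: Here $p=3$. Meromorphic differential forms on $\mathbb{P}^1_k$ are $f(X)\,dX$, $f\in k(X)$; order at $\infty$ is $\mathrm{ord}_0(f(1/X))-2$. A form is logarithmic if it equals $dF/F$ for some nonzero $F\in k(X)$. For positive integers $m,n$, a space $L_{m+1,n}$ is an $n$-dimensional $\mathbb{F}_p$-vector space of meromorphic differential forms on $\mathbb{P}^1_k$ whose nonzero elements are all logarithmic and each have a unique zero, located at $\infty$, of order $m-1$. Let $Q_1,Q_2\in k[X]$ be polynomials of degree $\lambda$ such that $\deg(iQ_1+jQ_2)=\lambda$ for every $[i:j]\in\mathbb{P}^1(\mathbb{F}_p)$. The pair $(Q_1,Q_2)$ is a prompt for a space $\Omega$ if there exists $c\in k^\times$ such that the two forms $\frac{dX}{c^p(Q_1Q_2^{p-1}-Q_1^p)}$ and $\frac{dX}{c^p(Q_2Q_1^{p-1}-Q_2^p)}$ form an $\mathbb{F}_p$-basis of $\Omega$. Two spaces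 $L_{m+1,n}$, $\Omega$ and $\Omega'$, are equivalent if there is an automorphism $\sigma$ of $\mathbb{P}^1_k$ with $\sigma(\infty)=\infty$ (i.e. $X\mapsto \alpha X+\beta$, $\alpha\in k^\times,\beta\in k$) such that $\Omega'=\sigma^*\Omega$. *)

(* Defs.v *)
From HB Require Import structures.
From mathcomp Require Import all_boot all_order all_algebra.
From mathcomp Require Import generic_quotient ring.

Set Implicit Arguments.
Unset Strict Implicit.
Unset Printing Implicit Defensive.

Import GRing.Theory.
Local Open Scope ring_scope.

Notation "x %:F" := (FracField.tofrac x) : ring_scope.

(* The meromorphic form f dX on the projective line is represented by the
   rational function f, so forms are elements of [ratfun k]. *)
Notation ratfun k := {fraction {poly k}}.

Section RationalFunctions.
Variable k : fieldType.
Implicit Types (f g F : ratfun k) (P Q : {poly k}).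

(* [rnum f / rden f] is an arbitrary, not necessarily reduced, representative;
   the lemmas [rderivE], [rordE] and [rsubstE] below state that the operations
   defined from it do not depend on it. *)
Definition rnum f : {poly k} := \n_(repr f).
Definition rden f : {poly k} := \d_(repr f).

Definition rderiv f : ratfun k :=
  ((rnum f)^`() * rden f - rnum f * (rden f)^`())%:F / (rden f ^+ 2)%:F.

(* Meaningful for [f != 0] only. *)
Definition rord (x : k) f : int := (mup x (rnum f))%:Z - (mup x (rden f))%:Z.

Definition reval P g : ratfun k := (map_poly (fun c => (c%:P)%:F) P).[g].

(* The rational function f(g); meaningful for nonconstant [g]. *)
Definition rsubst f g : ratfun k := reval (rnum f) g / reval (rden f) g.

Lemma rden_neq0 f : rden f != 0.
Proof. exact: denom_ratioP. Qed.

Lemma ratfunE f : f = (rnum f)%:F / (rden f)%:F.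
Proof.
rewrite -[f in LHS]reprK; set r := repr f.
have d0 : (rden f)%:F != 0 :> ratfun k by rewrite tofrac_eq0 rden_neq0.
apply: (mulIf d0); rewrite mulfVK //; unlock FracField.tofrac.
rewrite -[LHS]FracField.pi_mul; apply/eqmodP => /=.
rewrite FracField.equivfE /FracField.mulf !numden_Ratio ?oner_eq0 ?mulr1 ?denom_ratioP //.
by rewrite /rnum /rden -/r mulrC.
Qed.

Lemma rnum_eq0 f : (rnum f == 0) = (f == 0).
Proof.
by rewrite [in RHS](ratfunE f) mulf_eq0 invr_eq0 !tofrac_eq0 (negPf (rden_neq0 f)) orbF.
Qed.

Lemma rfrac_cross P Q : Q != 0 ->
  rnum (P%:F / Q%:F) * Q = P * rden (P%:F / Q%:F).
Proof.
move=> Q0; set f := P%:F / Q%:F; have D0 := rden_neq0 f.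
apply/eqP; rewrite -tofrac_eq !tofracM; apply/eqP.
have := ratfunE f; rewrite {1}/f => /eqP.
by rewrite eqr_div ?tofrac_eq0 // => /eqP ->.
Qed.

Lemma rderivE P Q : Q != 0 ->
  rderiv (P%:F / Q%:F) = (P^`() * Q - P * Q^`())%:F / (Q ^+ 2)%:F.
Proof.
move=> Q0; have := rfrac_cross P Q0; rewrite /rderiv.
set f := P%:F / Q%:F; have D0 := rden_neq0 f.
move: (rnum f) (rden f) D0 => N D D0 E.
have E' : N^`() * Q + N * Q^`() = P^`() * D + P * D^`() by rewrite -!derivM E.
apply/eqP; rewrite eqr_div ?tofrac_eq0 ?expf_neq0 // -!tofracM tofrac_eq.
rewrite -subr_eq0; apply/eqP.
transitivity ((N^`() * Q + N * Q^`() - (P^`() * D + P * D^`())) * (D * Q)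
  - (N * Q - P * D) * (D^`() * Q + D * Q^`())); first by ring.
by rewrite E' E !subrr !mul0r subrr.
Qed.

Lemma rordE x P Q : P != 0 -> Q != 0 ->
  rord x (P%:F / Q%:F) = (mup x P)%:Z - (mup x Q)%:Z.
Proof.
move=> P0 Q0; have := rfrac_cross P Q0; rewrite /rord.
set f := P%:F / Q%:F => E.
have N0 : rnum f != 0 by rewrite rnum_eq0 mulf_neq0 ?invr_eq0 ?tofrac_eq0.
have /(congr1 Posz) := congr1 (mup x) E.
rewrite !mupM ?rden_neq0 // !PoszD => {}E.
by apply/eqP; rewrite subr_eq addrAC eq_sym subr_eq eq_sym E.
Qed.

Lemma revalM P Q g : reval (P * Q) g = reval P g * reval Q g.
Proof.
rewrite /reval (rmorphM (map_poly ((@FracField.tofrac {poly k}) \o polyC))).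
exact: hornerM.
Qed.

Lemma rsubstE P Q g : (forall D, D != 0 -> reval D g != 0) -> Q != 0 ->
  rsubst (P%:F / Q%:F) g = reval P g / reval Q g.
Proof.
move=> g_transc Q0; apply/eqP; rewrite /rsubst.
by rewrite eqr_div ?g_transc ?rden_neq0 // -!revalM rfrac_cross // mulrC.
Qed.

Definition form_ord_inf f : int := rord 0 (rsubst f ('X%:F)^-1) - 2.

Definition logarithmic f := exists F, F != 0 /\ f = rderiv F / F.

Definition affine_pullback (alpha beta : k) f : ratfun k :=
  rsubst f (alpha *: 'X + beta%:P)%:F * (alpha%:P)%:F.

End RationalFunctions.

Section Spaces.
Variables (k : fieldType) (p : nat).
(* Used below only for [p] prime equal to the characteristic of [k]; then the
   action of c in 'F_p on a form w is [w *+ c]. *)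

Definition Fp_basis (n : nat) (w : 'I_n -> ratfun k) (Omega : ratfun k -> Prop) :=
  (forall f, Omega f <-> exists c : 'I_n -> 'F_p, f = \sum_i w i *+ c i) /\
  (forall c : 'I_n -> 'F_p, \sum_i w i *+ c i = 0 -> forall i, c i = 0).

(* [spaceL m n Omega]: Omega is a space L_{m+1,n}. *)
Definition spaceL (m n : nat) (Omega : ratfun k -> Prop) :=
  (exists w : 'I_n -> ratfun k, Fp_basis w Omega) /\
  (forall f, Omega f -> f != 0 ->
     [/\ logarithmic f,
         forall x : k, (rord x f <= 0)%R
       & form_ord_inf f = m%:Z - 1]).

Definition prompt_form (c : k) (P Q : {poly k}) : ratfun k :=
  (((c ^+ p) *: (P * Q ^+ p.-1 - P ^+ p))%:F)^-1.

Definition prompt (Q1 Q2 : {poly k}) (Omega : ratfun k -> Prop) :=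
  (exists lambda : nat,
     [/\ size Q1 = lambda.+1, size Q2 = lambda.+1 &
         forall i j : 'F_p, (i, j) != (0, 0) ->
           size (Q1 *+ i + Q2 *+ j) = lambda.+1]) /\
  (exists c : k, c != 0 /\
     Fp_basis (fun i : 'I_2 => if i == ord0 then prompt_form c Q1 Q2
                               else prompt_form c Q2 Q1) Omega).

Definition equivalent_spaces (Omega Omega' : ratfun k -> Prop) :=
  exists alpha beta : k, alpha != 0 /\
    forall f, Omega' f <-> exists g, Omega g /\ f = affine_pullback alpha beta g.

Definition in_prime_field (x : k) := exists i : 'F_p, x = (i : nat)%:R.

End Spaces.

Definition Q1 (k : fieldType) (a : k) : {poly k} :=
  'X^4 - (a ^+ 4 + a ^+ 2 - 1) *: 'X^2 + 1.

Definition Q2 (k : fieldType) (a : k) : {poly k} :=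
  a *: ('X^4 + (a ^+ 4 - a ^+ 2 - 1) *: 'X^2 + (a ^+ 8)%:P).

(* Main.v *)
(** A form [dX / P] is logarithmic in characteristic 3 iff [P'^2 + P P'' = 1].
    Comparing the denominators of the four lines of a space [L_{12,2}] shows
    that it is spanned by [1 / (A B^2 - A^3)] and [1 / (B A^2 - B^3)] with
    [A], [B] of degree 4, and all the conditions collapse to the single
    equation [A^3 (A B^2)'' + B^3 (A^2 B)'' = -1].  Both second derivatives
    are polynomials in [X^3], so this is a Bezout identity between [A^3] and
    [B^3] whose cofactors are cubic in the coefficient vectors
    [e_i = (a_i, b_i)].  Its leading coefficient makes [e_3] parallel to [e_4],
    hence [e_3 = 0] after a translation; expressing [e_1] and [e_0] in the basis
    [e_4, e_2] then forces [e_1 = 0], [e_2 = y e_4 + z e_4^3] and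
    [e_0 = x e_4 + y e_2] proportional to [e_4^9] (powers taken
    coordinatewise).  With [a = b_4 / a_4] the remaining unknown solves a cubic
    whose three roots are the values attached to [a], [a + 1] and [a + 2], so
    replacing [B] by [B], [B + A] or [B + 2 A] and rescaling [X] gives
    [(Q1 a, Q2 a)] up to a scalar. *)

Require Import Defs.
From mathcomp Require Import all_boot all_order all_algebra ring zify.

Set Implicit Arguments.
Unset Strict Implicit.
Unset Printing Implicit Defensive.

Import GRing.Theory.
Local Open Scope ring_scope.

(** * Arithmetic and differentiation in characteristic 3 *)

Lemma mul3_eq0 (R : comNzRingType) (n : nat) :
  3 = 0 :> R -> (3 * n)%:R = 0 :> R.
Proof. by move=> h; rewrite natrM h mul0r. Qed.

Lemma mulN3_eq0 (R : comNzRingType) (n : nat) :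
  3 = 0 :> R -> - (3 * n)%:R = 0 :> R.
Proof. by move=> h; rewrite natrM h mul0r oppr0. Qed.

(* [ring: e] only rewrites with exact coefficients, so every multiple of 3 that
   may occur as a coefficient needs its own equation. *)
Ltac ring3 h :=
  apply/eqP; rewrite -subr_eq0; apply/eqP;
  ring: (mul3_eq0 1%N h) (mul3_eq0 2%N h) (mul3_eq0 3%N h) (mul3_eq0 4%N h)
    (mul3_eq0 5%N h) (mul3_eq0 6%N h) (mul3_eq0 7%N h) (mul3_eq0 8%N h)
    (mul3_eq0 9%N h) (mul3_eq0 10%N h)
    (mulN3_eq0 1%N h) (mulN3_eq0 2%N h) (mulN3_eq0 3%N h) (mulN3_eq0 4%N h)
    (mulN3_eq0 5%N h) (mulN3_eq0 6%N h) (mulN3_eq0 7%N h) (mulN3_eq0 8%N h)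
    (mulN3_eq0 9%N h) (mulN3_eq0 10%N h).

Lemma poly3_eq0 (R : comNzRingType) : 3 = 0 :> R -> 3 = 0 :> {poly R}.
Proof. by move=> h; rewrite -polyC_natr h. Qed.

Lemma deriv3_eq0 (R : comNzRingType) (P : {poly R}) :
  3 = 0 :> R -> P^`()^`()^`() = 0.
Proof.
move=> h; have -> : P^`()^`()^`() = P^`(3) by [].
rewrite nderivn_def -mulr_natl (_ : 3`! = 3 * 2)%N //.
by rewrite mul3_eq0 ?mul0r //; apply: poly3_eq0.
Qed.

Lemma inv_eq_logderiv (F : fieldType) (p u n d : F) :
  p != 0 -> n != 0 -> d != 0 -> p^-1 = u / d ^+ 2 / (n / d) -> n * d = p * u.
Proof.
move=> p0 n0 d0 e; have -> : u = p^-1 * (n * d) by rewrite e; field; rewrite n0 d0.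
by rewrite mulrA divff ?mul1r.
Qed.

(** * Forms [1 / P] with [P] a polynomial: zeros, order at infinity, logarithmicity *)

Section InverseForms.
Variable k : closedFieldType.
Implicit Types (f F : ratfun k) (P Q H : {poly k}).

Lemma closed_pow (n : nat) (x : k) : (0 < n)%N -> exists y, y ^+ n = x.
Proof.
move=> n0; have [y Hy] := @solve_monicpoly k n (fun i => if i == 0%N then x else 0) n0.
exists y; rewrite Hy; case: n n0 {Hy} => // n _.
rewrite big_ord_recl /= expr0 mulr1 big1 ?addr0 // => i _.
by rewrite mul0r.
Qed.

Lemma tofrac_neq0 P : P != 0 -> P%:F != 0 :> ratfun k.
Proof. by rewrite tofrac_eq0. Qed.

Lemma rord_inv P (x : k) : P != 0 -> rord x (P%:F)^-1 = - (mup x P)%:Z.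
Proof.
move=> P0; have -> : (P%:F)^-1 = 1%:F / P%:F :> ratfun k by rewrite tofrac1 mul1r.
rewrite rordE ?oner_eq0 // mupNroot ?sub0r //.
by rewrite root1.
Qed.

(** In lowest terms, a nonconstant numerator has a root since [k] is algebraically closed, and there
    the form would have a zero. *)
Lemma no_zero_inv f : f != 0 -> (forall x, (rord x f <= 0)%R) ->
  exists2 P, P != 0 & f = (P%:F)^-1.
Proof.
move=> f0 Hord.
have [n [d [n0 d0 cop ef]]] : exists n d,
    [/\ n != 0, d != 0, coprimep n d & f = n%:F / d%:F].
  have N0 : rnum f != 0 by rewrite rnum_eq0.
  have D0 := rden_neq0 f; have ef := ratfunE f.
  move: (rnum f) (rden f) N0 D0 ef => N D N0 D0 ef.
  have cop : coprimep (N %/ gcdp N D) (D %/ gcdp N D).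
    by rewrite coprimep_div_gcd ?N0.
  have G0 : gcdp N D != 0 by rewrite gcdp_eq0 negb_and N0.
  have := divpK (dvdp_gcdl N D); have := divpK (dvdp_gcdr N D).
  move: cop G0; move: (gcdp N D) => G; move: (N %/ G) (D %/ G) => n d cop G0 eD eN.
  exists n, d; split=> //.
  - by apply: contraNneq N0 => e; rewrite -eN e mul0r.
  - by apply: contraNneq D0 => e; rewrite -eD e mul0r.
  have {}G0 := tofrac_neq0 G0.
  by rewrite ef -eN -eD (tofracM n G) (tofracM d G) -mulf_div (divff G0) mulr1.
have [/eqP/size_poly1P [u u0 nu]|s1] := eqVneq (size n) 1%N.
  exists (u^-1 *: d); first by rewrite scaler_eq0 negb_or invr_eq0 u0.
  rewrite ef nu -mul_polyC tofracM invfM; congr (_ * _).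
  apply: (mulIf (tofrac_neq0 (_ : (u^-1)%:P != 0))); first by rewrite polyC_eq0 invr_eq0.
  rewrite mulVf ?tofrac_neq0 ?polyC_eq0 ?invr_eq0 // -tofracM -polyCM (divff u0) //.
have [x rx] := closed_rootP n s1.
have rd : ~~ root d x by rewrite /root (coprimep_root cop rx).
have := Hord x; rewrite ef rordE // (mupNroot rd).
rewrite subr0 => H.
have : (0 < mup x n)%N by rewrite -XsubC_dvd // dvdp_XsubCl.
by move: H; case: (mup x n).
Qed.

Lemma revalE P g :
  reval P g = \sum_(i < size P) ((P`_i)%:P)%:F * g ^+ i.
Proof.
have -> : reval P g = (map_poly ((@FracField.tofrac {poly k}) \o polyC) P).[g] by [].
rewrite (horner_coef_wide _ (size_poly _ _)).
by apply: eq_bigr => i _; rewrite coef_map.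
Qed.

Lemma reval_Xinv P :
  reval P ('X%:F)^-1 =
    (\poly_(i < size P) P`_((size P).-1 - i))%:F / ('X^((size P).-1))%:F.
Proof.
have X0 : 'X%:F != 0 :> ratfun k by rewrite tofrac_neq0 ?polyX_eq0.
have Xn0 n : ('X^n)%:F != 0 :> ratfun k by rewrite tofrac_neq0 ?monic_neq0 ?monicXn.
apply: (mulIf (Xn0 (size P).-1)); rewrite (mulfVK (Xn0 _)) revalE mulr_suml.
rewrite poly_def rmorph_sum /= [RHS](reindex_inj rev_ord_inj) /=.
apply: eq_bigr => i _; have := ltn_ord i; move: (size P) i => n i lt_in.
rewrite -mul_polyC tofracM -mulrA; congr (_%:P%:F * _); first by congr (P`_ _); lia.
have -> : (n.-1 = (n - i.+1) + i)%N by lia.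
by rewrite tofracXn exprD mulrCA exprVn (mulVf (expf_neq0 i X0)) mulr1 tofracXn.
Qed.

Lemma form_ord_inf_inv P : P != 0 -> form_ord_inf (P%:F)^-1 = (size P).-1%:Z - 2.
Proof.
move=> P0; rewrite /form_ord_inf; congr (_ - _).
(* The constant term of the reciprocal polynomial is the leading coefficient of [Q], so only the
   power of [X] contributes to the order at 0. *)
have rev0 Q : Q != 0 -> (\poly_(i < size Q) Q`_((size Q).-1 - i)).[0] != 0.
  move=> Q0; rewrite horner_coef0 coef_poly size_poly_gt0 Q0 subn0.
  by rewrite -lead_coefE lead_coef_eq0.
have rev0' Q : Q != 0 -> \poly_(i < size Q) Q`_((size Q).-1 - i) != 0.
  by move=> /rev0; apply: contraNneq => ->; rewrite horner0.
have Xn0 n : ('X^n) != 0 :> {poly k} by rewrite monic_neq0 ?monicXn.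
have -> : (P%:F)^-1 = 1%:F / P%:F :> ratfun k by rewrite tofrac1 mul1r.
rewrite rsubstE //; last first.
  move=> D D0; rewrite reval_Xinv mulf_neq0 ?invr_eq0 ?tofrac_neq0 ?rev0' //.
rewrite [reval P _]reval_Xinv.
have -> : reval 1 ('X%:F)^-1 = 1 :> ratfun k.
  by rewrite revalE size_poly1 big_ord1 coef1 expr0 mulr1 tofrac1.
rewrite mul1r invf_div rordE ?rev0' //.
rewrite [mup 0 (\poly_(_ < _) _)]mupNroot ?subr0; last by rewrite /root rev0.
by rewrite -['X]subr0 mup_XsubCX eqxx.
Qed.

(** Some [H] satisfies [H = P H']. Differentiating twice and using [H''' = 0] gives two linear
    relations between [H'] and [H'']; eliminating [H''] leaves the equation times [H']. *)
Lemma logarithmic_inv_eq P : 3 = 0 :> k -> P != 0 ->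
  logarithmic (P%:F)^-1 -> P^`() ^+ 2 + P * P^`()^`() = 1.
Proof.
move=> h3 P0 [F [F0]]; have p3 := poly3_eq0 h3.
have N0 : rnum F != 0 by rewrite rnum_eq0.
have D0 : rden F != 0 := rden_neq0 F.
rewrite {2}(ratfunE F) /rderiv; move: (rnum F) (rden F) N0 D0 => N D N0 D0 e.
(* [N / D] and [N * D ^+ 2] have the same logarithmic derivative. *)
pose H := N * D ^+ 2.
have H0 : H != 0 by rewrite mulf_neq0 ?expf_neq0.
have PH : H = P * H^`().
  have {e}e : N * D = P * (N^`() * D - N * D^`()).
    apply/eqP; rewrite -tofrac_eq (tofracM N D) (tofracM P); apply/eqP.
    apply: inv_eq_logderiv; rewrite ?tofrac_neq0 //.
    by rewrite e tofracXn.
  rewrite /H expr2 !derivM.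
  transitivity (N * D * D); first by ring.
  by rewrite e; ring3 p3.
clearbody H; have H1 : H^`() != 0 by apply: contraNneq H0 => h; rewrite PH h mulr0.
have d1 := congr1 (@deriv k) PH; rewrite derivM in d1.
have d2 := congr1 (@deriv k) d1; rewrite derivD !derivM deriv3_eq0 // in d2.
apply: (mulIf H1); rewrite mul1r.
move: d1 d2; move: H^`() H^`()^`() => U V d1 d2.
(* The multipliers [1 - 2 P'] and [P] cancel every term in [V]; modulo 3 the coefficient of [U] is
   then 1. *)
transitivity ((P^`() ^+ 2 + P * P^`()^`()) * U
   + (1 - 2 * P^`()) * (U - (P^`() * U + P * V))
   + P * (V - (P^`()^`() * U + P^`() * V + (P^`() * V + P * 0)))).
  by rewrite -d1 -d2 !subrr !mulr0 !addr0.
ring3 p3.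
Qed.

Lemma inv_logarithmic P : 3 = 0 :> k -> (2 < size P)%N ->
  P^`() ^+ 2 + P * P^`()^`() = 1 -> logarithmic (P%:F)^-1.
Proof.
move=> h3 sP eP; have p3 := poly3_eq0 h3.
have P0 : P != 0 by rewrite -size_poly_gt0; lia.
(* The operator [g |-> g' - g / P] has p-curvature zero, so its solutions are
   the truncated Taylor sums [g - X (Dg) + X^2 / 2 (D^2 g)]; this is the one
   for [g = 1], multiplied by [P ^+ 3]. *)
pose G := P ^+ 2 + ('X * P - 'X^2 * (P^`() + 1)).
(* The hypothesis on [size P] makes [P ^+ 2] strictly dominate the other terms in degree. *)
have G0 : G != 0.
  have s0 : size (P ^+ 2) = (size P + size P).-1 by rewrite expr2 size_mul.
  have s1 : size ('X * P) = (size P).+1 by rewrite mulrC size_mulX.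
  have s2 : (size ('X^2 * (P^`() + 1))%R <= (size P).+1)%N.
    have := size_polyMleq 'X^2 (P^`() + 1); rewrite size_polyXn.
    have := size_polyD P^`() 1; rewrite size_poly1.
    have := lt_size_deriv P0; lia.
  have := size_polyD ('X * P) (- ('X^2 * (P^`() + 1))); rewrite size_polyN => s3.
  rewrite -size_poly_gt0 /G size_polyDl s0; first by lia.
  apply: leq_ltn_trans s3 _; rewrite s1 gtn_max (leq_ltn_trans s2) ?andbT; lia.
have GP : (P * G)^`() = G.
  rewrite /G derivM !(derivD, derivN, derivM, derivX, derivXn, derivC, derivE) /=.
  transitivity (P ^+ 2 + 'X * P - 'X^2 * P^`() - 'X^2 * (P^`() ^+ 2 + P * P^`()^`())).
    by ring3 p3.
  by rewrite eP; ring.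
exists (P * G)%:F; rewrite tofrac_neq0 ?mulf_neq0 //; split=> //.
rewrite -[X in rderiv X]divr1 -tofrac1 rderivE ?oner_eq0 //.
rewrite derivC mulr0 subr0 mulr1 expr1n tofrac1 divr1 GP tofracM invfM.
by rewrite mulrC mulfVK ?tofrac_neq0.
Qed.

End InverseForms.

(** * Pairs of quartics with [bez A B = -1], and the linear substitutions over F_3 acting on them *)

Section GoodPairs.
Variable k : closedFieldType.
Implicit Types (f : ratfun k) (A B P : {poly k}).

(* Writing [f = 1 / (A B^2 - A^3)], one has [f'' + f^3 = (1 + bez A B) f^3]; the
   symmetry of [bez] makes the conditions for all elements of the span equivalent. *)
Definition bez A B : {poly k} :=
  A ^+ 3 * (A * B ^+ 2)^`()^`() + B ^+ 3 * (A ^+ 2 * B)^`()^`().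

Definition good_pair A B :=
  [/\ size A = 5, size B = 5, size (A + B) = 5, size (A - B) = 5
    & bez A B = -1].

Definition pform A B : ratfun k := ((A * B ^+ 2 - A ^+ 3)%:F)^-1.

Definition pspan A B f :=
  exists i j : 'F_3, f = pform A B *+ i + pform B A *+ j.

Hypothesis h3 : 3 = 0 :> k.
Let p3 : 3 = 0 :> {poly k} := poly3_eq0 h3.

Ltac expand_deriv :=
  rewrite /bez ?exprS ?expr0 ?mulr1 !(derivD, derivN, derivM).

Lemma bezE A B (P := A * B ^+ 2 - A ^+ 3) :
  P^`() ^+ 2 + P * P^`()^`() = - bez A B.
Proof. rewrite /P; expand_deriv; ring3 p3. Qed.

Lemma bezC A B : bez B A = bez A B.
Proof. expand_deriv; ring. Qed.

Lemma bezNl A B : bez (- A) B = bez A B.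
Proof. expand_deriv; ring. Qed.

(** With the swap and the sign change this gives invariance under all of GL_2(F_3), which these
    three substitutions generate. *)
Lemma bezDl A B : bez (A + B) B = bez A B.
Proof. expand_deriv; ring3 p3. Qed.

Lemma bez_rot A B : bez (A + B) (A - B) = bez A B.
Proof.
have -> : A - B = B + (A + B) - 3 * B by ring.
by rewrite p3 mul0r subr0 bezC bezDl bezC bezDl.
Qed.

Lemma good_pairC A B : good_pair A B -> good_pair B A.
Proof.
case=> sA sB sD sS e; split; [exact: sB | exact: sA | | |].
- by rewrite addrC sD.
- by rewrite -opprB size_polyN sS.
- by rewrite bezC e.
Qed.

Lemma good_pairNl A B : good_pair A B -> good_pair (- A) B.
Proof.
case=> sA sB sD sS e; split; [by rewrite size_polyN sA | exact: sB | | |].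
- by rewrite addrC -opprB size_polyN sS.
- by rewrite -opprD size_polyN sD.
- by rewrite bezNl e.
Qed.

Lemma good_pair_rot A B : good_pair A B -> good_pair (A + B) (A - B).
Proof.
case=> sA sB sD sS e; split; [exact: sD | exact: sS | | | by rewrite bez_rot e].
  have -> : A + B + (A - B) = - A + 3 * A by ring.
  by rewrite p3 mul0r addr0 size_polyN sA.
have -> : A + B - (A - B) = - B + 3 * B by ring.
by rewrite p3 mul0r addr0 size_polyN sB.
Qed.

Lemma good_pairDr A B : good_pair A B -> good_pair A (B + A).
Proof.
case=> sA sB sD sS e; split; [exact: sA | by rewrite addrC sD | | |].
- have -> : A + (B + A) = - (A - B) + 3 * A by ring.
  by rewrite p3 mul0r addr0 size_polyN sS.
- have -> : A - (B + A) = - B by ring.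
  by rewrite size_polyN sB.
- by rewrite bezC bezDl bezC e.
Qed.

Lemma size_good_pair A B : good_pair A B -> size (A * B ^+ 2 - A ^+ 3) = 13.
Proof.
case=> sA sB sD sS _.
have nz P : size P = 5 -> P != 0 by rewrite -size_poly_eq0 => ->.
have -> : A * B ^+ 2 - A ^+ 3 = - (A * ((A + B) * (A - B))) by ring.
by rewrite size_polyN !size_mul ?mulf_neq0 ?nz // sA sD sS.
Qed.

Lemma good_pform A B : good_pair A B ->
  [/\ pform A B != 0, logarithmic (pform A B),
      forall x : k, (rord x (pform A B) <= 0)%R
    & form_ord_inf (pform A B) = 11%:Z - 1].
Proof.
move=> gAB; have s := size_good_pair gAB.
have P0 : A * B ^+ 2 - A ^+ 3 != 0 by rewrite -size_poly_eq0 s.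
have [_ _ _ _ e] := gAB; split.
- by rewrite invr_eq0 tofrac_neq0.
- by apply: inv_logarithmic; rewrite ?s ?bezE ?e ?opprK.
- by move=> x; rewrite rord_inv // Num.Theory.oppr_le0.
- by rewrite form_ord_inf_inv // s.
Qed.

Lemma pformNl A B : pform (- A) B = - pform A B.
Proof. by rewrite /pform -invrN -tofracN; congr (_%:F)^-1; ring. Qed.

(** Up to sign each denominator is the product of three of the four factors [a], [b], [a + b],
    [a - b], so this is a partial fraction identity. *)
Lemma pform_add_aux (F : fieldType) (a b : F) : 3 = 0 :> F ->
  a != 0 -> b != 0 -> a + b != 0 -> a - b != 0 ->
  (a * b ^+ 2 - a ^+ 3)^-1 + (b * a ^+ 2 - b ^+ 3)^-1 =
    - ((a + b) * (a - b) ^+ 2 - (a + b) ^+ 3)^-1.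
Proof.
move=> f3 a0 b0 s0 d0.
have -> : a * b ^+ 2 - a ^+ 3 = - (a * ((a + b) * (a - b))) by ring.
have -> : b * a ^+ 2 - b ^+ 3 = b * ((a + b) * (a - b)) by ring.
have -> : (a + b) * (a - b) ^+ 2 - (a + b) ^+ 3 = - (a * b * (a + b)) by ring3 f3.
by rewrite !invrN opprK; field; rewrite a0 b0 s0 d0.
Qed.

Lemma ratfun3_eq0 : 3 = 0 :> ratfun k.
Proof. by rewrite -(rmorph_nat (@FracField.tofrac {poly k})) /= p3 tofrac0. Qed.

Lemma ratfun_mulr2n f : f *+ 2 = - f.
Proof.
apply/eqP; rewrite -addr_eq0 -mulrSr -mulr_natl; apply/eqP.
by rewrite ratfun3_eq0 mul0r.
Qed.

Lemma pformD A B : good_pair A B ->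
  pform A B + pform B A = - pform (A + B) (A - B).
Proof.
case=> sA sB sD sS _.
have nz P : size P = 5 -> P%:F != 0 :> ratfun k.
  by move=> s; rewrite tofrac_neq0 // -size_poly_eq0 s.
have E P Q : (P * Q ^+ 2 - P ^+ 3)%:F = P%:F * Q%:F ^+ 2 - P%:F ^+ 3 :> ratfun k.
  by rewrite tofracB (tofracM P) !tofracXn.
have s0 := nz _ sD; have d0 := nz _ sS; rewrite tofracD in s0; rewrite tofracB in d0.
have := pform_add_aux ratfun3_eq0 (nz _ sA) (nz _ sB) s0 d0.
by rewrite -tofracD -tofracB -!E.
Qed.

(** This transfers the properties of one [pform] to every nonzero element of the span. Up to sign
    there are four cases: the two generators, their sum and their difference. *)
Lemma good_pair_comb A B (i j : 'F_3) : good_pair A B -> (i, j) != (0, 0) ->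
  exists A' B', good_pair A' B' /\ pform A B *+ i + pform B A *+ j = pform A' B'.
Proof.
move=> gAB.
have gBA := good_pairC gAB; have gR := good_pair_rot gAB.
have gNAB := good_pairNl gAB; have gNBA := good_pairC (good_pairNl gBA).
have pr A' B' : pform A' (- B') = pform A' B' by rewrite /pform sqrrN.
have pD := pformD gAB.
have pB : pform A B - pform B A = pform (B - A) (A + B).
  have := pformD gNBA; rewrite pr pformNl opprK => ->.
  by rewrite -pformNl opprB.
case: i => [[|[|[|i]]] lti] //; case: j => [[|[|[|j]]] ltj] //= nz;
  rewrite ?mulr0n ?mulr1n ?ratfun_mulr2n ?add0r ?addr0.
- by exists B, A.
- by exists (- B), A; split; [exact: good_pairNl | rewrite pformNl].
- by exists A, B.
- by exists (- (A + B)), (A - B); rewrite pD pformNl; split=> //; exact: good_pairNl.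
- exists (B - A), (A + B); split=> //.
  by rewrite -[B - A]opprB; apply/good_pairNl/good_pairC.
- by exists (- A), B; split; rewrite ?pformNl.
- exists (A - B), (A + B); split; first exact: good_pairC.
  by rewrite -[A - B]opprB pformNl -pB opprB addrC.
- by exists (A + B), (A - B); split=> //; rewrite -opprD pD opprK.
Qed.

End GoodPairs.

(** * Every space L_{12,2} is spanned by the forms of a good pair *)

Lemma inv_add_cross (F : fieldType) (p q r : F) : p != 0 -> q != 0 -> r != 0 ->
  p^-1 + q^-1 = r^-1 -> p * q = r * (p + q).
Proof.
move=> p0 q0 r0 e; have -> : p + q = p * q * (p^-1 + q^-1) by field; rewrite p0 q0.
by rewrite e mulrCA divff ?mulr1.
Qed.

Lemma inv_sub_cross (F : fieldType) (p q r : F) : p != 0 -> q != 0 -> r != 0 ->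
  p^-1 - q^-1 = r^-1 -> p * q = r * (q - p).
Proof.
move=> p0 q0 r0 e; have -> : q - p = p * q * (p^-1 - q^-1) by field; rewrite p0 q0.
by rewrite e mulrCA divff ?mulr1.
Qed.

Section Spaces.
Variable k : closedFieldType.
Hypothesis h3 : 3 = 0 :> k.
Implicit Types (f : ratfun k) (A B P : {poly k}).
Let p3 : 3 = 0 :> {poly k} := poly3_eq0 h3.

Definition pair_fun (T : Type) (x y : T) (i : 'I_2) := if i == ord0 then x else y.

Lemma pspan_sum f A B : pspan A B f <->
  exists c : 'I_2 -> 'F_3, f = \sum_i pair_fun (pform A B) (pform B A) i *+ c i.
Proof.
split=> [[i [j ->]]|[c ->]].
  exists (pair_fun i j).
  by rewrite !big_ord_recl big_ord0 addr0.
by exists (c ord0), (c (lift ord0 ord0)); rewrite !big_ord_recl big_ord0 addr0.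
Qed.

Lemma good_Fp_basis A B : good_pair A B ->
  Fp_basis 3 (pair_fun (pform A B) (pform B A)) (pspan A B).
Proof.
move=> gAB; split=> [f|c]; first exact: pspan_sum.
rewrite !big_ord_recl big_ord0 addr0 /pair_fun /= => e i.
have [[c0 c1]|nz] := eqVneq (c ord0, c (lift ord0 ord0)) (0, 0).
  case: i => [[|[|i]] lti] //; [rewrite -[RHS]c0 | rewrite -[RHS]c1].
    by congr c; apply: val_inj.
  by congr c; apply: val_inj.
have [A' [B' [g e']]] := good_pair_comb h3 gAB nz.
have [/eqP nz' _ _ _] := good_pform h3 g.
by case: nz'; rewrite -e' e.
Qed.

Lemma good_spaceL A B : good_pair A B -> spaceL 3 11 2 (pspan A B).
Proof.
move=> gAB; split; first by exists (pair_fun (pform A B) (pform B A)); apply: good_Fp_basis.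
move=> f [i [j ->]] f0.
have nz : (i, j) != (0, 0).
  by apply: contraNneq f0 => -[-> ->]; rewrite !mulr0n addr0.
have [A' [B' [g ->]]] := good_pair_comb h3 gAB nz.
by have [_ ? ? ?] := good_pform h3 g.
Qed.

Lemma coprimep_addsub A B : coprimep A B ->
  [/\ coprimep (A + B) (A * B), coprimep (A - B) (A * B) & coprimep (A + B) (A - B)].
Proof.
move=> /Bezout_eq1_coprimepP [[u v] /= e]; split.
- rewrite coprimepMr; apply/andP; split; apply/Bezout_eq1_coprimepP.
    by exists (v, u - v) => /=; rewrite -e; ring.
  by exists (u, v - u) => /=; rewrite -e; ring.
- rewrite coprimepMr; apply/andP; split; apply/Bezout_eq1_coprimepP.
    by exists (- v, u + v) => /=; rewrite -e; ring.
  by exists (u, v + u) => /=; rewrite -e; ring.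
apply/Bezout_eq1_coprimepP; exists (- u - v, - u + v) => /=.
by rewrite -e; ring3 p3.
Qed.

(** At a root of [H] both equations reduce to [(H' K A)^2 = (H' K B)^2 = 1]. Their difference reads
    [(H' K)^2 K = 0], so [H' K] vanishes there, which is absurd. *)
Lemma separable_common_factor A B H K P1 P2 (x : k) :
  P1 = H * K * A -> P2 = H * K * B -> K = A ^+ 2 - B ^+ 2 ->
  P1^`() ^+ 2 + P1 * P1^`()^`() = 1 -> P2^`() ^+ 2 + P2 * P2^`()^`() = 1 ->
  ~~ root H x.
Proof.
move=> e1 e2 eK L1 L2; apply/negP => /rootP Hx.
have D1 : P1^`().[x] = H^`().[x] * K.[x] * A.[x].
  by rewrite e1 !derivM !hornerE Hx; ring.
have D2 : P2^`().[x] = H^`().[x] * K.[x] * B.[x].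
  by rewrite e2 !derivM !hornerE Hx; ring.
have := congr1 (horner^~ x) L1; have := congr1 (horner^~ x) L2.
rewrite /= !(hornerD, horner_exp, hornerM, hornerC) D1 D2 e1 e2 !hornerM Hx !mul0r !addr0.
rewrite eK !(hornerD, hornerN, horner_exp).
move: A.[x] B.[x] H^`().[x] => a b h E2 E1.
have E : (h * (a ^+ 2 - b ^+ 2)) ^+ 2 * (a ^+ 2 - b ^+ 2) = 0.
  transitivity ((h * (a ^+ 2 - b ^+ 2) * a) ^+ 2 - (h * (a ^+ 2 - b ^+ 2) * b) ^+ 2); first by ring.
  by rewrite E1 E2 subrr.
have/eqP := E1; have/eqP := E.
rewrite mulf_eq0 expf_eq0 mulf_eq0 /= => /orP[/orP[]|] /eqP ->;
  by rewrite ?mulr0 ?mul0r ?expr0n /= eq_sym oner_eq0.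
Qed.

(** [P3] and [P4] are the denominators of the sum and difference of [1 / P1] and [1 / P2]. Dividing
    by the gcd [G] of [P1] and [P2] shows that [(A + B) (A - B)] divides [G], and the cofactor turns
    out to be constant. *)
Lemma log_pencil_structure P1 P2 P3 P4 :
  size P1 = 13 -> size P2 = 13 -> size P3 = 13 -> size P4 = 13 ->
  P1^`() ^+ 2 + P1 * P1^`()^`() = 1 -> P2^`() ^+ 2 + P2 * P2^`()^`() = 1 ->
  P1 * P2 = P3 * (P1 + P2) -> P1 * P2 = P4 * (P2 - P1) ->
  exists A B, [/\ good_pair A B, P1 = A * B ^+ 2 - A ^+ 3 & P2 = B * A ^+ 2 - B ^+ 3].
Proof.
move=> s1 s2 s3 s4 L1 L2 E3 E4.
have nz P : size P = 13 -> P != 0 by move=> s; rewrite -size_poly_eq0 s.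
have P10 := nz _ s1; have P20 := nz _ s2; have P30 := nz _ s3; have P40 := nz _ s4.
have G0 : gcdp P1 P2 != 0 by rewrite gcdp_eq0 negb_and P10.
have cop : coprimep (P1 %/ gcdp P1 P2) (P2 %/ gcdp P1 P2).
  by rewrite coprimep_div_gcd ?P10.
have := divpK (dvdp_gcdl P1 P2); have := divpK (dvdp_gcdr P1 P2).
move: cop G0; move: (gcdp P1 P2) => G; move: (P1 %/ G) (P2 %/ G) => A B cop G0 eB eA.
have [cS cD cSD] := coprimep_addsub cop.
have e3 : A * B * G = P3 * (A + B).
  apply: (mulIf G0); transitivity (A * G * (B * G)); first by ring.
  by rewrite eA eB E3 -eA -eB; ring.
have e4 : A * B * G = P4 * (B - A).
  apply: (mulIf G0); transitivity (A * G * (B * G)); first by ring.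
  by rewrite eA eB E4 -eA -eB; ring.
(* [A + B] and [A - B] are coprime to [A * B] and to each other, so by [e3] and [e4] their product
   divides [G]. *)
have /dvdpP [H eG] : (A + B) * (A - B) %| G.
  rewrite Gauss_dvdp // -(Gauss_dvdpr _ cS) -(Gauss_dvdpr G cD) e3 dvdp_mulIr /=.
  by rewrite -e3 e4 -[B - A]opprB mulrN -mulNr dvdp_mulIr.
have H0 : H != 0 by apply: contraNneq G0 => h; rewrite eG h mul0r.
have A0 : A != 0 by apply: contraNneq P10 => h; rewrite -eA h mul0r.
have B0 : B != 0 by apply: contraNneq P20 => h; rewrite -eB h mul0r.
have S0 : A + B != 0 by apply: contraNneq G0 => h; rewrite eG h mul0r mulr0.
have D0 : A - B != 0 by apply: contraNneq G0 => h; rewrite eG h !mulr0.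
have [h hE] : exists h : k, H = h%:P.
  have [/eqP/size_poly1P [u _ ->]|/closed_rootP [x rx]] := eqVneq (size H) 1%N.
    by exists u.
  suff : ~~ root H x by rewrite rx.
  apply: (@separable_common_factor A B H (A ^+ 2 - B ^+ 2) P1 P2) => //.
    by rewrite -eA eG; ring.
  by rewrite -eB eG; ring.
have h0 : h != 0 by move: H0; rewrite hE polyC_eq0.
have {}e3 : P3 = H * (A * (B * (A - B))).
  by apply: (mulIf S0); rewrite -e3 eG; ring.
have {}e4 : P4 = - (H * (A * (B * (A + B)))).
  by apply: (mulIf D0); rewrite -[A - B]opprB mulrN -e4 eG; ring.
have {eA}e1 : P1 = H * (A * ((A + B) * (A - B))) by rewrite -eA eG; ring.
have {eB}e2 : P2 = H * (B * ((A + B) * (A - B))) by rewrite -eB eG; ring.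
(* The denominators are cubic forms in [(A, B)], so a cube root of [- h] absorbs the constant [H]
   into both quartics. *)
have [c ec] := closed_pow (- h) (isT : (0 < 3)%N).
have c0 : c != 0 by apply: contraNneq h0 => c0; rewrite -oppr_eq0 -ec c0 expr0n.
have sH : size H = 1%N by rewrite hE size_polyC h0.
(* All four products of three of the factors have degree 12, which forces each factor to have degree
   4. *)
have [sA [sB [sS sD]]] : size A = 5 /\ size B = 5 /\ size (A + B) = 5 /\ size (A - B) = 5.
  move: s1 s2 s3 s4; rewrite e1 e2 e3 e4 size_polyN !size_mul ?mulf_neq0 // sH.
  move: A0 B0 S0 D0; rewrite -!size_poly_gt0.
  move: (size A) (size B) (size (A + B)) (size (A - B)); clear.
  by case=> [|a] // [|b] // [|s] // [|d] // _ _ _ _; rewrite !(addSn, addnS) /=; lia.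
have eH : H = - (c%:P) ^+ 3 by rewrite hE -polyC_exp ec polyCN opprK.
have E1 : P1 = c *: A * (- (c *: B)) ^+ 2 - (c *: A) ^+ 3.
  by rewrite e1 eH -!mul_polyC; ring.
(* The sign on [B] is dictated by [P2]; the expression for [P1] is even in [B]. *)
exists (c *: A), (- (c *: B)); split=> //; last by rewrite e2 eH -!mul_polyC; ring.
split; rewrite ?size_polyN -?scalerN -?scalerDr -?scalerBr ?size_scale ?opprK //.
by rewrite scalerN -[bez _ _]opprK -bezE // -E1 L1.
Qed.

Lemma spaceL_good (Omega : ratfun k -> Prop) : spaceL 3 11 2 Omega ->
  exists A B, good_pair A B /\ forall f, Omega f <-> pspan A B f.
Proof.
case=> [[w [wspan wfree]] wlog].
pose w0 := w ord0; pose w1 := w (lift ord0 ord0).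
have comb (i j : 'F_3) : (i, j) != (0, 0) ->
    exists P, [/\ size P = 13, P^`() ^+ 2 + P * P^`()^`() = 1
                & w0 *+ i + w1 *+ j = (P%:F)^-1].
  move=> ij; pose c := pair_fun i j.
  have sc : \sum_i w i *+ c i = w0 *+ i + w1 *+ j.
    by rewrite !big_ord_recl big_ord0 addr0.
  have f0 : w0 *+ i + w1 *+ j != 0.
    apply: contraNneq ij; rewrite -sc => /wfree c0.
    by rewrite -[i]/(c ord0) -[j]/(c (lift ord0 ord0)) !c0.
  have Of : Omega (w0 *+ i + w1 *+ j) by apply/wspan; exists c.
  have [lf of0 oinf] := wlog _ Of f0.
  have [P P0 eP] := no_zero_inv f0 of0.
  rewrite eP in lf oinf *; exists P; split=> //; last exact: logarithmic_inv_eq.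
  by move: oinf; rewrite form_ord_inf_inv //; lia.
have [P1 [s1 L1]] := comb 1 0 isT; rewrite mulr0n addr0 mulr1n => e1.
have [P2 [s2 L2]] := comb 0 1 isT; rewrite mulr0n add0r mulr1n => e2.
have [P3 [s3 _]] := comb 1 1 isT; rewrite mulr1n e1 e2 => e3.
have [P4 [s4 _]] := comb 1 (-1) isT; rewrite mulr1n e1 e2 => e4.
have nz P : size P = 13 -> P%:F != 0 :> ratfun k.
  by move=> s; rewrite tofrac_neq0 // -size_poly_eq0 s.
have E3 : P1 * P2 = P3 * (P1 + P2).
  apply/eqP; rewrite -tofrac_eq (tofracM P1) (tofracM P3) tofracD; apply/eqP.
  exact: inv_add_cross (nz _ s1) (nz _ s2) (nz _ s3) e3.
have E4 : P1 * P2 = P4 * (P2 - P1).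
  apply/eqP; rewrite -tofrac_eq (tofracM P1) (tofracM P4) tofracB; apply/eqP.
  apply: inv_sub_cross (nz _ s1) (nz _ s2) (nz _ s4) _; rewrite -e4; congr (_ + _).
  by rewrite (_ : (-1 : 'F_3) = 2 :> nat) // ratfun_mulr2n.
have [A [B [gAB EA EB]]] := log_pencil_structure s1 s2 s3 s4 L1 L2 E3 E4.
exists A, B; split=> // f.
have wE : w =1 pair_fun (pform A B) (pform B A).
  rewrite /pform -EA -EB -e1 -e2 => -[[|[|i]] lti] //; rewrite /pair_fun /=;
  by congr w; apply: val_inj.
apply: iff_trans (wspan f) (iff_trans _ (iff_sym (pspan_sum f A B))).
by split=> -[c ->]; exists c; apply: eq_bigr => i _; rewrite wE.
Qed.

End Spaces.

(** * Coefficients of [bez] for polynomials of degree at most 4 *)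

Lemma cubeD (F : comNzRingType) (x y : F) : 3 = 0 :> F ->
  (x + y) ^+ 3 = x ^+ 3 + y ^+ 3.
Proof. by move=> h; ring3 h. Qed.

Section Coefficients.
Variable k : closedFieldType.
Hypothesis h3 : 3 = 0 :> k.
Implicit Types (A B P : {poly k}).
Let p3 : 3 = 0 :> {poly k} := poly3_eq0 h3.

Lemma poly5E A : (size A <= 5)%N ->
  A = (A`_4)%:P * 'X^4 + (A`_3)%:P * 'X^3 + (A`_2)%:P * 'X^2 + (A`_1)%:P * 'X + (A`_0)%:P.
Proof.
move=> s; apply/polyP => i; rewrite !coefD !coefCM !coefXn coefX coefC.
case: i => [|[|[|[|[|i]]]]]; rewrite ?(mulr1, mulr0, addr0, add0r) //.
by rewrite nth_default // (leq_trans s).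
Qed.

Lemma poly5_cube A : (size A <= 5)%N ->
  A ^+ 3 = (A`_4 ^+ 3)%:P * 'X^12 + (A`_3 ^+ 3)%:P * 'X^9 + (A`_2 ^+ 3)%:P * 'X^6
    + (A`_1 ^+ 3)%:P * 'X^3 + (A`_0 ^+ 3)%:P.
Proof.
move=> /poly5E {1}->; rewrite !cubeD // !polyC_exp; ring.
Qed.

(** Differentiating twice multiplies the coefficient of index [n] by [n (n - 1)], which modulo 3 is
    -1 for [n] congruent to 2 and 0 otherwise. *)
Lemma deriv2_mod3 P : (size P <= 13)%N ->
  P^`()^`() = - ((P`_11)%:P * 'X^9 + (P`_8)%:P * 'X^6 + (P`_5)%:P * 'X^3 + (P`_2)%:P).
Proof.
move=> s; apply/polyP => i; rewrite coefN !coefD !coefCM !coefXn coefC !coef_deriv.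
rewrite -mulrnA -[LHS]mulr_natl.
have [lti|lei] := ltnP i 11; last first.
  have -> : P`_i.+2 = 0 by rewrite nth_default // (leq_trans s).
  case: i lei => [|[|[|[|[|[|[|[|[|[|[|i]]]]]]]]]]] // _.
  by rewrite /= !(mulr0, addr0, oppr0).
have z n x : (3 * n)%:R * x = 0 :> k by rewrite mul3_eq0 ?mul0r.
have m n x : (3 * n).+2%:R * x = - x :> k.
  by rewrite -addn2 natrD mulrDl z add0r; ring3 h3.
case: i lti => [|[|[|[|[|[|[|[|[|[|[|i]]]]]]]]]]] // _;
  rewrite /= ?(mulr1, mulr0, addr0, add0r, oppr0).
- exact: (m 0%N).
- exact: (z 2%N).
- exact: (z 4%N).
- exact: (m 6%N).
- exact: (z 10%N).
- exact: (z 14%N).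
- exact: (m 18%N).
- exact: (z 24%N).
- exact: (z 30%N).
- exact: (m 36%N).
- exact: (z 44%N).
Qed.

Lemma size_cubic A B : (size A <= 5)%N -> (size B <= 5)%N ->
  (size (A * B ^+ 2)%R <= 13)%N.
Proof.
move=> sA sB; have := size_polyMleq A (B ^+ 2); have := size_polyMleq B B.
rewrite -expr2 => s1 s2; apply: leq_trans s2 _.
set n := size (B ^+ 2) in s1 *; lia.
Qed.

(** Up to sign, the contribution to the coefficient of [X^(3 i + j - 2)] in [bez A B]: cubes carry
    the exponents [3 i], and only [j] congruent to 2 modulo 3 survives the second derivative. *)
Definition bez_pair A B (i j : nat) : k :=
  A`_i ^+ 3 * (A * B ^+ 2)`_j + B`_i ^+ 3 * (B * A ^+ 2)`_j.

Lemma bez_expand A B (t := bez_pair A B) : (size A <= 5)%N -> (size B <= 5)%N ->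
  bez A B = - ((t 4 11)%:P * 'X^21 + (t 4 8 + t 3 11)%:P * 'X^18
    + (t 4 5 + t 3 8 + t 2 11)%:P * 'X^15
    + (t 4 2 + t 3 5 + t 2 8 + t 1 11)%:P * 'X^12
    + (t 3 2 + t 2 5 + t 1 8 + t 0 11)%:P * 'X^9
    + (t 2 2 + t 1 5 + t 0 8)%:P * 'X^6
    + (t 1 2 + t 0 5)%:P * 'X^3 + (t 0 2)%:P).
Proof.
move=> sA sB; rewrite /bez [A ^+ 2 * B]mulrC.
rewrite (deriv2_mod3 (size_cubic sA sB)) (deriv2_mod3 (size_cubic sB sA)).
rewrite (poly5_cube sA) (poly5_cube sB) /t /bez_pair.
move: (A * B ^+ 2) (B * A ^+ 2) => U V; ring.
Qed.

(** Only the indices that survive the second derivative are listed; the default value 0 carries no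
    information. *)
Definition cubic_coef (a4 a3 a2 a1 a0 b4 b3 b2 b1 b0 : k) (n : nat) : k :=
  match n with
  | 11 => a4 * (2 * b4 * b3) + a3 * b4 ^+ 2
  | 8 => a4 * (2 * b4 * b0 + 2 * b3 * b1 + b2 ^+ 2) + a3 * (2 * b4 * b1 + 2 * b3 * b2)
         + a2 * (2 * b4 * b2 + b3 ^+ 2) + a1 * (2 * b4 * b3) + a0 * b4 ^+ 2
  | 5 => a4 * (2 * b1 * b0) + a3 * (2 * b2 * b0 + b1 ^+ 2)
         + a2 * (2 * b3 * b0 + 2 * b2 * b1)
         + a1 * (2 * b4 * b0 + 2 * b3 * b1 + b2 ^+ 2) + a0 * (2 * b4 * b1 + 2 * b3 * b2)
  | 2 => a2 * b0 ^+ 2 + a1 * (2 * b1 * b0) + a0 * (2 * b2 * b0 + b1 ^+ 2)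
  | _ => 0
  end.

Lemma coef_cubic A B (n : nat) : (size A <= 5)%N -> (size B <= 5)%N ->
  n \in [:: 11; 8; 5; 2] ->
  (A * B ^+ 2)`_n = cubic_coef A`_4 A`_3 A`_2 A`_1 A`_0 B`_4 B`_3 B`_2 B`_1 B`_0 n.
Proof.
move=> /poly5E eA /poly5E eB.
pose a i := A`_i; pose b i := B`_i.
pose s7 := 2 * b 4 * b 3; pose s6 := 2 * b 4 * b 2 + b 3 ^+ 2.
pose s5 := 2 * b 4 * b 1 + 2 * b 3 * b 2.
pose s4 := 2 * b 4 * b 0 + 2 * b 3 * b 1 + b 2 ^+ 2.
pose s3 := 2 * b 3 * b 0 + 2 * b 2 * b 1; pose s2 := 2 * b 2 * b 0 + b 1 ^+ 2.
pose s1 := 2 * b 1 * b 0.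
have eB2 : B ^+ 2 = (b 4 ^+ 2)%:P * 'X^8 + s7%:P * 'X^7 + s6%:P * 'X^6 + s5%:P * 'X^5
    + s4%:P * 'X^4 + s3%:P * 'X^3 + s2%:P * 'X^2 + s1%:P * 'X + (b 0 ^+ 2)%:P.
  by rewrite {1}eB /s7 /s6 /s5 /s4 /s3 /s2 /s1 /b; ring.
have -> : A * B ^+ 2 = (a 4 * b 4 ^+ 2)%:P * 'X^12
    + (a 4 * s7 + a 3 * b 4 ^+ 2)%:P * 'X^11
    + (a 4 * s6 + a 3 * s7 + a 2 * b 4 ^+ 2)%:P * 'X^10
    + (a 4 * s5 + a 3 * s6 + a 2 * s7 + a 1 * b 4 ^+ 2)%:P * 'X^9
    + (a 4 * s4 + a 3 * s5 + a 2 * s6 + a 1 * s7 + a 0 * b 4 ^+ 2)%:P * 'X^8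
    + (a 4 * s3 + a 3 * s4 + a 2 * s5 + a 1 * s6 + a 0 * s7)%:P * 'X^7
    + (a 4 * s2 + a 3 * s3 + a 2 * s4 + a 1 * s5 + a 0 * s6)%:P * 'X^6
    + (a 4 * s1 + a 3 * s2 + a 2 * s3 + a 1 * s4 + a 0 * s5)%:P * 'X^5
    + (a 4 * b 0 ^+ 2 + a 3 * s1 + a 2 * s2 + a 1 * s3 + a 0 * s4)%:P * 'X^4
    + (a 3 * b 0 ^+ 2 + a 2 * s1 + a 1 * s2 + a 0 * s3)%:P * 'X^3
    + (a 2 * b 0 ^+ 2 + a 1 * s1 + a 0 * s2)%:P * 'X^2
    + (a 1 * b 0 ^+ 2 + a 0 * s1)%:P * 'X + (a 0 * b 0 ^+ 2)%:P.
  rewrite eB2 {1}eA -/(a 4) -/(a 3) -/(a 2) -/(a 1) -/(a 0).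
  by move: s7 s6 s5 s4 s3 s2 s1 (b 4) (b 0) {eB2} => *; ring.
rewrite !inE => /or4P[] /eqP ->;
  rewrite !coefD !coefCM !coefXn coefX coefC /= ?(mulr1, mulr0, addr0, add0r);
  by rewrite /s7 /s6 /s5 /s4 /s3 /s2 /s1 /a /b.
Qed.

End Coefficients.

(** * The polynomial system for pairs of quartics without cubic term *)

Section ScalarSystem.
Variable k : fieldType.
Hypothesis h3 : 3 = 0 :> k.

Let mulf0 (x y : k) : x != 0 -> x * y = 0 -> y = 0.
Proof. by move=> x0 /eqP; rewrite mulf_eq0 (negPf x0) => /eqP. Qed.

Variables a4 a2 a1 a0 b4 b2 b1 b0 : k.
(** The 2 x 2 minors of the coefficient vectors [e_i = (a_i, b_i)]. *)
Let D42 := a4 * b2 - a2 * b4.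
Let D04 := a0 * b4 - a4 * b0.
Let D41 := a4 * b1 - a1 * b4.
Let D12 := a1 * b2 - a2 * b1.
Let D10 := a1 * b0 - a0 * b1.
Let D20 := a2 * b0 - a0 * b2.
(** Modulo 3, [u2], [u1], [u0] are the coefficients of [A * B ^+ 2] at [X^8], [X^5], [X^2] when the
    cubic terms vanish, and [v2], [v1], [v0] are those of [B * A ^+ 2]. Hypothesis [En] below is
    then the coefficient of [X^(3 n)] in [- bez A B = 1]. *)
Variables u2 v2 u1 v1 u0 v0 : k.
Hypotheses (u2E : u2 = D42 * b2 + D04 * b4) (v2E : v2 = - (D42 * a2 + D04 * a4)).
Hypotheses (u1E : u1 = D12 * b2 - D41 * b0 + D10 * b4)
           (v1E : v1 = - (D12 * a2 - D41 * a0 + D10 * a4)).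
Hypotheses (u0E : u0 = D20 * b0 - D10 * b1) (v0E : v0 = - (D20 * a0 - D10 * a1)).
Hypotheses (a4_neq0 : a4 != 0) (b4_neq0 : b4 != 0).
(** Up to sign the Moore determinant of [a4] and [b4]: it vanishes only when they are linearly
    dependent over F_3. *)
Let delta := a4 ^+ 3 * b4 - b4 ^+ 3 * a4.
Hypothesis delta_neq0 : delta != 0.
Let t (x y u v : k) := x ^+ 3 * u + y ^+ 3 * v.
Hypotheses
  (E6 : t a4 b4 u2 v2 = 0)
  (E5 : t a4 b4 u1 v1 = 0)
  (E4 : t a4 b4 u0 v0 + t a2 b2 u2 v2 = 0)
  (E3 : t a2 b2 u1 v1 + t a1 b1 u2 v2 = 0)
  (E2 : t a2 b2 u0 v0 + t a1 b1 u1 v1 + t a0 b0 u2 v2 = 0)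
  (E1 : t a1 b1 u0 v0 + t a0 b0 u1 v1 = 0)
  (E0 : t a0 b0 u0 v0 = 1).

(** If [e_2] were parallel to [e_4], so would be [e_0] by [E6], and [E0] keeps [e_1] off that line.
    Then [(a1 : b1)] is both rational over F_3 and the Frobenius image of [(a4 : b4)], which
    contradicts [delta_neq0]. *)
Lemma D42_neq0 : D42 != 0.
Proof.
apply/negP => /eqP D0.
have D04_0 : D04 = 0.
  apply: (mulf0 delta_neq0); rewrite -E6 /t u2E v2E D0 /delta; ring.
have u20 : u2 = 0 by rewrite u2E D0 D04_0; ring.
have v20 : v2 = 0 by rewrite v2E D0 D04_0; ring.
pose x := a2 / a4; pose w := a0 / a4.
have ea2 : a2 = x * a4 by rewrite /x mulfVK.
have eb2 : b2 = x * b4.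
  apply: (mulfI a4_neq0); apply/eqP; rewrite -subr_eq0 -[X in _ == X]D0.
  by rewrite /D42 ea2; apply/eqP; ring.
have ea0 : a0 = w * a4 by rewrite /w mulfVK.
have eb0 : b0 = w * b4.
  apply: (mulfI a4_neq0); apply/eqP; rewrite eq_sym -subr_eq0 -[X in _ == X]D04_0.
  by rewrite /D04 ea0; apply/eqP; ring.
have D20_0 : D20 = 0 by rewrite /D20 ea2 eb2 ea0 eb0; ring.
have D10E : D10 = - w * D41 by rewrite /D10 /D41 ea0 eb0; ring.
have D10_0 : D10 != 0.
  apply/eqP => D1; have/esym/eqP := E0; rewrite /t u0E v0E D20_0 D1.
  by rewrite !mul0r subrr oppr0 !mulr0 addr0 oner_eq0.
have D41_0 : D41 != 0 by apply: contraNneq D10_0 => D1; rewrite D10E D1 mulr0.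
have wE : w = x ^+ 2.
  have : delta * D41 * (w - x ^+ 2) = 0.
    rewrite -[RHS]E5 /t u1E v1E D10E /D12 ea2 eb2 ea0 eb0 /delta /D41; ring3 h3.
  move/mulf0 => /(_ (mulf_neq0 delta_neq0 D41_0)) /eqP.
  by rewrite subr_eq0 => /eqP.
have u10 : u1 = 0.
  by rewrite u1E D10E /D12 ea2 eb2 eb0 /D41 wE; ring3 h3.
have v10 : v1 = 0.
  by rewrite v1E D10E /D12 ea2 eb2 ea0 /D41 wE; ring3 h3.
have F4 : a4 ^+ 3 * b1 = b4 ^+ 3 * a1.
  apply/eqP; rewrite -subr_eq0; apply/eqP/(mulf0 D10_0).
  by apply: oppr_inj; rewrite oppr0 -[RHS]E4 /t u20 v20 u0E v0E D20_0; ring.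
have F1 : a1 ^+ 3 * b1 = b1 ^+ 3 * a1.
  apply/eqP; rewrite -subr_eq0; apply/eqP/(mulf0 D10_0).
  by apply: oppr_inj; rewrite oppr0 -[RHS]E1 /t u10 v10 u0E v0E D20_0; ring.
have a10 : a1 != 0.
  apply: contraNneq D41_0 => a10; rewrite /D41 a10 mul0r subr0.
  have := F4; rewrite a10 mulr0 => /mulf0 -> //; last by rewrite expf_neq0.
  by rewrite mulr0.
have b10 : b1 != 0.
  apply: contraNneq a10 => b10; apply/eqP.
  by have := F4; rewrite b10 mulr0 => /esym/mulf0 -> //; rewrite expf_neq0.
have F9 : b4 ^+ 9 * a1 = a4 ^+ 9 * b1.
  apply: (mulfI (expf_neq0 3 b10)).
  transitivity (b4 ^+ 9 * (b1 ^+ 3 * a1)); first by ring.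
  rewrite -F1; transitivity ((b4 ^+ 3 * a1) ^+ 3 * b1); first by ring.
  by rewrite -F4; ring.
have : delta ^+ 3 * a1 = 0.
  transitivity (a4 ^+ 9 * (b4 ^+ 3 * a1) - b4 ^+ 9 * a1 * a4 ^+ 3); first by rewrite /delta; ring3 h3.
  by rewrite -F4 F9; ring.
by move/mulf0 => /(_ (expf_neq0 3 delta_neq0)) /eqP; rewrite (negPf a10).
Qed.

Lemma scalar_system_solution : exists x0 y0 z : k,
  [/\ z != 0, x0 != 0, a1 = 0 & b1 = 0] /\
  [/\ a2 = y0 * a4 + z * a4 ^+ 3, b2 = y0 * b4 + z * b4 ^+ 3,
      a0 = x0 * a4 + y0 * a2 & b0 = x0 * b4 + y0 * b2] /\
  [/\ x0 * a0 = - z ^+ 4 * a4 ^+ 9 & x0 * b0 = - z ^+ 4 * b4 ^+ 9].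
Proof.
have D0 := D42_neq0.
(* Cramer's rule: [e_0 = x0 e_4 + y0 e_2] and [e_1 = x1 e_4 + y1 e_2]. *)
pose x0 := - D20 / D42; pose y0 := - D04 / D42.
pose x1 := D12 / D42; pose y1 := D41 / D42.
have solve (p q r : k) : D42 * p = q * a4 + r * a2 -> p = q / D42 * a4 + r / D42 * a2.
  by move=> e; apply: (mulfI D0); rewrite e; field.
have solveb (p q r : k) : D42 * p = q * b4 + r * b2 -> p = q / D42 * b4 + r / D42 * b2.
  by move=> e; apply: (mulfI D0); rewrite e; field.
have ea0 : a0 = x0 * a4 + y0 * a2 by apply: solve; rewrite /D20 /D04 /D42; ring.
have eb0 : b0 = x0 * b4 + y0 * b2 by apply: solveb; rewrite /D20 /D04 /D42; ring.
have ea1 : a1 = x1 * a4 + y1 * a2 by apply: solve; rewrite /D12 /D41 /D42; ring.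
have eb1 : b1 = x1 * b4 + y1 * b2 by apply: solveb; rewrite /D12 /D41 /D42; ring.
have eD20 : D20 = - x0 * D42 by rewrite mulNr mulfVK ?opprK.
have eD04 : D04 = - y0 * D42 by rewrite mulNr mulfVK ?opprK.
have eD12 : D12 = x1 * D42 by rewrite /x1 mulfVK.
have eD41 : D41 = y1 * D42 by rewrite /y1 mulfVK.
have eD10 : D10 = (x1 * y0 - x0 * y1) * D42.
  by rewrite /D10 ea0 eb0 ea1 eb1 /D42; ring.
clearbody x0 y0 x1 y1.
(* [E6] says that [e_2 - y0 e_4] is parallel to the coordinatewise cube of [e_4]; [z] is the
   ratio. *)
pose z := (a2 - y0 * a4) / a4 ^+ 3.
have a430 : a4 ^+ 3 != 0 by rewrite expf_neq0.
have za : a2 - y0 * a4 = z * a4 ^+ 3 by rewrite /z mulfVK.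
have zb : b2 - y0 * b4 = z * b4 ^+ 3.
  apply: (mulfI a430); transitivity (b4 ^+ 3 * (a2 - y0 * a4)); last by rewrite za; ring.
  apply/eqP; rewrite -subr_eq0; apply/eqP/(mulf0 D0).
  by rewrite -[RHS]E6 /t u2E v2E eD04; ring.
clearbody z.
have ea2 : a2 = y0 * a4 + z * a4 ^+ 3 by rewrite -za; ring.
have eb2 : b2 = y0 * b4 + z * b4 ^+ 3 by rewrite -zb; ring.
have D42E : D42 = - z * delta by rewrite /D42 ea2 eb2 /delta; ring.
have z0 : z != 0 by apply: contraNneq D0 => z0; rewrite D42E z0 oppr0 mul0r.
(* [E5] will show that [(u1, v1)] is [xi] times [(u2, v2)]. *)
pose xi := x1 - y0 * y1.
have sigma : x1 * y0 + x0 * y1 = - xi * y0.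
  apply/eqP; rewrite -subr_eq0; apply/eqP/(mulf0 (mulf_neq0 D0 delta_neq0)).
  rewrite -[RHS]E5 /t u1E v1E eD12 eD41 eD10 ea0 eb0 /delta /xi.
  transitivity (D42 * ((x1 - y0 * y1) * (a4 ^+ 3 * (b2 - y0 * b4) - b4 ^+ 3 * (a2 - y0 * a4))
    + (x1 * y0 + x0 * y1 - - (x1 - y0 * y1) * y0) * (a4 ^+ 3 * b4 - b4 ^+ 3 * a4))).
    by rewrite za zb; ring.
  ring3 h3.
have u2F : u2 = D42 * z * b4 ^+ 3.
  by rewrite u2E eD04 -mulrA -zb; ring.
have v2F : v2 = - (D42 * z * a4 ^+ 3).
  by rewrite v2E eD04 -[_ * z * _]mulrA -za; ring.
have u1F : u1 = D42 * z * xi * b4 ^+ 3.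
  transitivity (D42 * (xi * b2 + (x1 * y0 + x0 * y1) * b4)).
    by rewrite u1E eD12 eD41 eD10 eb0 /xi; ring3 h3.
  by rewrite sigma eb2; ring.
have v1F : v1 = - (D42 * z * xi * a4 ^+ 3).
  transitivity (- (D42 * (xi * a2 + (x1 * y0 + x0 * y1) * a4))).
    by rewrite v1E eD12 eD41 eD10 ea0 /xi; ring3 h3.
  by rewrite sigma ea2; ring.
have xiE : xi = x1 - y0 * y1 by [].
clearbody xi.
pose K := a4 ^+ 3 * b2 ^+ 3 - a2 ^+ 3 * b4 ^+ 3.
have KE : K = D42 ^+ 3 by rewrite /K /D42; ring3 h3.
have K0 : K != 0 by rewrite KE expf_neq0.
have ca0 : a0 ^+ 3 = x0 ^+ 3 * a4 ^+ 3 + y0 ^+ 3 * a2 ^+ 3 by rewrite ea0 cubeD // !exprMn.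
have cb0 : b0 ^+ 3 = x0 ^+ 3 * b4 ^+ 3 + y0 ^+ 3 * b2 ^+ 3 by rewrite eb0 cubeD // !exprMn.
have ca1 : a1 ^+ 3 = x1 ^+ 3 * a4 ^+ 3 + y1 ^+ 3 * a2 ^+ 3 by rewrite ea1 cubeD // !exprMn.
have cb1 : b1 ^+ 3 = x1 ^+ 3 * b4 ^+ 3 + y1 ^+ 3 * b2 ^+ 3 by rewrite eb1 cubeD // !exprMn.
have Dz0 : D42 * z * K != 0 by rewrite !mulf_neq0.
(* Cubing being additive, [E3] reduces to a multiple of [K] and determines [xi]. *)
have {}xi1 : xi = - y1 ^+ 3.
  apply/eqP; rewrite -subr_eq0 opprK; apply/eqP/(mulf0 Dz0)/oppr_inj.
  by rewrite oppr0 -[RHS]E3 /t u1F v1F u2F v2F ca1 cb1 /K; ring.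
(* [E4] and [E2] give the pairings of [(u0, v0)] with the cubes of [e_4] and [e_2]; [E1] then
   becomes the relation [F1]. *)
pose q4 := t a4 b4 u0 v0; pose q2 := t a2 b2 u0 v0.
have q4E : q4 = D42 * z * K.
  apply/eqP; rewrite -subr_eq0; apply/eqP.
  by rewrite -[RHS]E4 /q4 /t u2F v2F /K; ring.
have q2E : q2 = D42 * z * K * (xi * y1 ^+ 3 + y0 ^+ 3).
  apply/eqP; rewrite -subr_eq0; apply/eqP.
  by rewrite -[RHS]E2 /q2 /t u2F v2F u1F v1F ca0 cb0 ca1 cb1 /K; ring.
have F1 : x1 ^+ 3 = y1 ^+ 9 + y0 ^+ 3 * y1 ^+ 3.
  apply/eqP; rewrite -subr_eq0; apply/eqP/(mulf0 Dz0).
  transitivity (x1 ^+ 3 * q4 + y1 ^+ 3 * q2 - D42 * z * K * xi * y0 ^+ 3).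
    by rewrite q4E q2E xi1; ring3 h3.
  by rewrite -[RHS]E1 /q4 /q2 /t u1F v1F ca0 cb0 ca1 cb1 /K; ring.
have x1E : x1 = y0 * y1 - y1 ^+ 3 by rewrite -xi1 xiE; ring.
(* Comparing [F1] with the cube of [x1E] leaves [y1 ^+ 9 = 0]. *)
have y10 : y1 = 0.
  have : y1 ^+ 9 = 0.
    transitivity ((y0 * y1 - y1 ^+ 3) ^+ 3 - x1 ^+ 3); last by rewrite -x1E subrr.
    by rewrite F1; ring3 h3.
  by move/eqP; rewrite expf_eq0 => /eqP.
have x10 : x1 = 0 by rewrite x1E y10; ring.
have a10 : a1 = 0 by rewrite ea1 x10 y10; ring.
have b10 : b1 = 0 by rewrite eb1 x10 y10; ring.
have u0F : u0 = - x0 * D42 * b0 by rewrite u0E eD20 b10; ring.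
have v0F : v0 = x0 * D42 * a0 by rewrite v0E eD20 a10; ring.
have x00 : x0 != 0.
  apply/eqP => x00; have/esym/eqP := E0; rewrite /t u0F v0F x00.
  by rewrite oppr0 !mul0r !mulr0 addr0 oner_eq0.
(* Subtracting [y0 ^+ 3 * q4] from [q2] isolates the pairing of [(u0, v0)] with the ninth power of
   [e_4], which is therefore zero. *)
have par : a4 ^+ 9 * b0 = b4 ^+ 9 * a0.
  apply/eqP; rewrite -subr_eq0; apply/eqP.
  apply: (mulf0 (mulf_neq0 (mulf_neq0 x00 D0) (expf_neq0 3 z0))); apply: oppr_inj.
  transitivity (q2 - y0 ^+ 3 * q4).
    rewrite /q2 /q4 /t u0F v0F ea2 eb2 !cubeD // !exprMn; ring.
  by rewrite q2E q4E y10; ring.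
have x0a0 : x0 * a0 = - z ^+ 4 * a4 ^+ 9.
  apply: (mulfI (mulf_neq0 D0 (expf_neq0 3 delta_neq0))).
  transitivity (D42 * z * K * a4 ^+ 9); last first.
    by rewrite KE D42E; ring.
  rewrite -q4E /q4 /t u0F v0F.
  transitivity (- x0 * D42 * (a4 ^+ 3 * (a4 ^+ 9 * b0) - b4 ^+ 3 * a4 ^+ 9 * a0)).
    by rewrite par /delta; ring3 h3.
  by ring.
exists x0, y0, z; split; first by split.
split; first by split.
split=> //; apply: (mulfI (expf_neq0 9 a4_neq0)).
transitivity (x0 * (a4 ^+ 9 * b0)); first by ring.
rewrite par; transitivity (b4 ^+ 9 * (x0 * a0)); first by ring.
by rewrite x0a0; ring.
Qed.

End ScalarSystem.

(** * Normal form of good pairs without cubic term *)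

Lemma normal_form_roots (k : fieldType) (a g x0 y0 : k) : 3 = 0 :> k ->
  g != 0 -> a ^+ 2 != 1 -> x0 != 0 ->
  x0 * (x0 + y0 ^+ 2 + y0 * g) = - g ^+ 4 ->
  x0 * (x0 + y0 ^+ 2 + y0 * g * a ^+ 2) = - (g ^+ 4 * a ^+ 8) ->
  x0 * y0 = - (g ^+ 3 * ((a ^+ 2 + 1) * (a ^+ 4 + 1))) /\
  [\/ x0 = - (g * (a ^+ 2 + 1)) ^+ 2, x0 = - (g * ((a + 1) ^+ 2 + 1)) ^+ 2
    | x0 = - (g * ((a + 1 + 1) ^+ 2 + 1)) ^+ 2].
Proof.
move=> h3 g0 a1 x00 F1 F2.
have d0 : g * (a ^+ 2 - 1) != 0 by rewrite mulf_neq0 ?subr_eq0.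
have xy : x0 * y0 = - (g ^+ 3 * ((a ^+ 2 + 1) * (a ^+ 4 + 1))).
  apply: (mulfI d0); apply/eqP; rewrite -subr_eq0.
  have -> : g * (a ^+ 2 - 1) * (x0 * y0) - g * (a ^+ 2 - 1) * - (g ^+ 3 * ((a ^+ 2 + 1) * (a ^+ 4 + 1)))
    = (x0 * (x0 + y0 ^+ 2 + y0 * g * a ^+ 2) - - (g ^+ 4 * a ^+ 8))
      - (x0 * (x0 + y0 ^+ 2 + y0 * g) - - g ^+ 4) by ring.
  by rewrite F1 F2 !subrr.
split=> //.
(* Eliminating [y0] between [F1] and the value of [x0 * y0] gives a cubic in [x0]. *)
have cub : x0 ^+ 3 - g ^+ 4 * (a ^+ 2 * (a ^+ 2 - 1) ^+ 2) * x0
    + g ^+ 6 * ((a ^+ 2 + 1) * (a ^+ 4 + 1)) ^+ 2 = 0.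
  transitivity (x0 * (x0 * (x0 + y0 ^+ 2 + y0 * g) - - g ^+ 4)
     - (x0 * y0 - - (g ^+ 3 * ((a ^+ 2 + 1) * (a ^+ 4 + 1))))
       * (x0 * y0 + x0 * g - g ^+ 3 * ((a ^+ 2 + 1) * (a ^+ 4 + 1))) ).
    by ring3 h3.
  by rewrite F1 xy !subrr mulr0 mul0r subrr.
have e1 : (a + 1) ^+ 2 + 1 = a ^+ 2 - a - 1 by ring3 h3.
have e2 : (a + 1 + 1) ^+ 2 + 1 = a ^+ 2 + a - 1 by ring3 h3.
rewrite e1 e2.
(* The roots are minus the squares of [g (s^2 + 1)] for [s] equal to [a], [a + 1] and [a + 2]. *)
have : (x0 + (g * (a ^+ 2 + 1)) ^+ 2) * ((x0 + (g * (a ^+ 2 - a - 1)) ^+ 2)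
     * (x0 + (g * (a ^+ 2 + a - 1)) ^+ 2)) = 0.
  by rewrite -[RHS]cub; ring3 h3.
move/eqP; rewrite !mulf_eq0 !addr_eq0 => /or3P[] /eqP ->.
- by apply: Or31.
- by apply: Or32.
- by apply: Or33.
Qed.

Section NormalForm.
Variable k : closedFieldType.
Hypothesis h3 : 3 = 0 :> k.
Implicit Types (A B P : {poly k}).

Lemma size5_lead P : size P = 5 -> P`_4 != 0.
Proof.
by move=> s; have -> : P`_4 = lead_coef P by [rewrite lead_coefE s];
  rewrite lead_coef_eq0 -size_poly_eq0 s.
Qed.

Lemma good_pair_lead A B : good_pair A B ->
  [/\ A`_4 != 0, B`_4 != 0, A`_4 + B`_4 != 0 & A`_4 - B`_4 != 0].
Proof.
by case=> /size5_lead a /size5_lead b /size5_lead; rewrite coefD => ab /size5_lead;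
  rewrite coefB.
Qed.

Lemma cube_poly_eq1 (c7 c6 c5 c4 c3 c2 c1 c0 : k) :
  c7%:P * 'X^21 + c6%:P * 'X^18 + c5%:P * 'X^15 + c4%:P * 'X^12
    + c3%:P * 'X^9 + c2%:P * 'X^6 + c1%:P * 'X^3 + c0%:P = 1 ->
  [/\ c7 = 0, c6 = 0, c5 = 0 & c4 = 0] /\ [/\ c3 = 0, c2 = 0, c1 = 0 & c0 = 1].
Proof.
move=> /polyP e; move: (e 21) (e 18) (e 15) (e 12) (e 9) (e 6) (e 3) (e 0).
rewrite !coefD !coefCM !coefXn !coefC /= !(mulr1, mulr0, addr0, add0r).
by move=> *; split.
Qed.

Lemma good_pair_coef_eqs A B (t := bez_pair A B) : good_pair A B ->
  [/\ t 4 11 = 0, t 4 8 + t 3 11 = 0, t 4 5 + t 3 8 + t 2 11 = 0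
    & t 4 2 + t 3 5 + t 2 8 + t 1 11 = 0] /\
  [/\ t 3 2 + t 2 5 + t 1 8 + t 0 11 = 0, t 2 2 + t 1 5 + t 0 8 = 0,
      t 1 2 + t 0 5 = 0 & t 0 2 = 1].
Proof.
case=> sA sB _ _; rewrite bez_expand ?sA ?sB // => /oppr_inj.
exact: cube_poly_eq1.
Qed.

(** Modulo 3 the coefficient of [X^21] in [bez A B] is, up to sign, the minor of the two top
    coefficient vectors times the leading coefficients of [A], [B], [A + B], [A - B]. *)
Lemma good_pair_coef3 A B : good_pair A B -> A`_3 * B`_4 = A`_4 * B`_3.
Proof.
move=> gAB; have [[E _ _ _] _] := good_pair_coef_eqs gAB.
have [a0 b0 s0 d0] := good_pair_lead gAB; have [sA sB _ _ _] := gAB.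
move: E; rewrite /bez_pair !coef_cubic ?sA ?sB // /cubic_coef /= => E.
apply/eqP; rewrite -subr_eq0.
have : (A`_4 * B`_4 * ((A`_4 + B`_4) * (A`_4 - B`_4))) * (A`_3 * B`_4 - A`_4 * B`_3) = 0.
  by rewrite -[RHS]E; ring3 h3.
by move/eqP; rewrite !mulf_eq0 (negPf a0) (negPf b0) (negPf s0) (negPf d0).
Qed.

(* Additive in [P] because cubing is; hence stable under [B |-> B + A]. *)
Definition reduced (x0 y0 z : k) P :=
  [/\ (size P <= 5)%N, P`_3 = 0 & P`_1 = 0] /\
  [/\ P`_2 = y0 * P`_4 + z * P`_4 ^+ 3, P`_0 = x0 * P`_4 + y0 * P`_2
    & x0 * P`_0 = - z ^+ 4 * P`_4 ^+ 9].

Lemma reducedD x0 y0 z A B :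
  reduced x0 y0 z A -> reduced x0 y0 z B -> reduced x0 y0 z (A + B).
Proof.
case=> [[sA a3 a1] [a2 a0 a9]] [[sB b3 b1] [b2 b0 b9]]; rewrite /reduced !coefD.
split; split.
- by rewrite (leq_trans (size_polyD _ _)) // geq_max sA sB.
- by rewrite a3 b3 addr0.
- by rewrite a1 b1 addr0.
- by rewrite a2 b2 cubeD //; ring.
- by rewrite a0 b0; ring.
- have p9 (x y : k) : (x + y) ^+ 9 = x ^+ 9 + y ^+ 9.
    by rewrite -[9%N]/(3 * 3)%N !exprM !cubeD.
  by rewrite p9 !mulrDr a9 b9.
Qed.

Lemma good_pair_reduced A B : good_pair A B -> A`_3 = 0 -> B`_3 = 0 ->
  exists x0 y0 z, [/\ z != 0, x0 != 0, reduced x0 y0 z A & reduced x0 y0 z B].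
Proof.
move=> gAB a3 b3; have [[_ E6 E5 E4] [E3 E2 E1 E0]] := good_pair_coef_eqs gAB.
have [a40 b40 s0 d0] := good_pair_lead gAB; have [sA sB _ _ _] := gAB.
(* Without cubic terms every summand with [i = 3] or [j = 11] vanishes, which leaves the seven
   equations of the scalar system. *)
have t3 n : bez_pair A B 3 n = 0 by rewrite /bez_pair a3 b3 expr0n /= !mul0r addr0.
have t11 i : bez_pair A B i 11 = 0.
  by rewrite /bez_pair !coef_cubic ?sA ?sB // /cubic_coef /= a3 b3; ring.
rewrite !t3 !t11 ?addr0 ?add0r in E6 E5 E4 E3.
have delta0 : A`_4 ^+ 3 * B`_4 - B`_4 ^+ 3 * A`_4 != 0.
  have -> : A`_4 ^+ 3 * B`_4 - B`_4 ^+ 3 * A`_4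
    = A`_4 * B`_4 * ((A`_4 + B`_4) * (A`_4 - B`_4)) by ring.
  by rewrite !mulf_neq0.
have [| | | | | |x0 [y0 [z [[z0 x00 a1 b1] [[a2 b2 a0 b0] [a9 b9]]]]]] :=
  scalar_system_solution h3 _ _ _ _ _ _ a40 b40 delta0 E6 E5 E4 E3 E2 E1 E0;
  rewrite ?coef_cubic ?sA ?sB // /cubic_coef /= ?a3 ?b3; try by ring3 h3.
exists x0, y0, z; split=> //; split; split=> //; by rewrite ?sA ?sB.
Qed.

(** The hypothesis on [x0] selects, among the three possible roots, the one attached to [a] itself;
    all other coefficients then follow from [a], the leading coefficient of [A] and a scaling of
    [X]. *)
Lemma reduced_normal_form A B x0 y0 z (a := B`_4 / A`_4) :
  good_pair A B -> z != 0 -> x0 != 0 ->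
  reduced x0 y0 z A -> reduced x0 y0 z B ->
  x0 = - (z * A`_4 ^+ 2 * (a ^+ 2 + 1)) ^+ 2 ->
  exists alpha c, [/\ alpha != 0, c != 0, A \Po (alpha *: 'X) = c *: Q1 a,
    B \Po (alpha *: 'X) = c *: Q2 a & ~ in_prime_field 3 (a ^+ 2)].
Proof.
move=> gAB z0 x00 rA rB x0E.
have [c0 b40 s0 d0] := good_pair_lead gAB.
have [[sA a3 a1] [a2 a0 a9]] := rA; have [[sB b3 b1] [b2 b0 b9]] := rB.
have b4E : B`_4 = A`_4 * a by rewrite mulrC /a mulfVK.
have eA := poly5E sA; have eB := poly5E sB.
rewrite a3 a1 in eA; rewrite b3 b1 in eB; rewrite {}b4E in b2 b0 b9 b40 s0 d0 eB.
move: (A`_4) (A`_2) (A`_0) (B`_2) (B`_0) c0 a2 a0 a9 b2 b0 b9 b40 s0 d0 x0E eA eB.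
rewrite -/a; move: a => {rA rB sA sB a3 a1 b3 b1} a c A2 A0 B2 B0.
move=> c0 a2 a0 a9 b2 b0 b9 b40 s0 d0 x0E eA eB.
have a_neq0 : a != 0 by apply: contraNneq b40 => ->; rewrite mulr0.
have a1 : a ^+ 2 != 1.
  rewrite -subr_eq0 (_ : a ^+ 2 - 1 = (a - 1) * (a + 1)); last by ring.
  rewrite mulf_neq0 //; [apply: contraNneq d0 | apply: contraNneq s0] => e.
    have -> : c - c * a = - c * (a - 1) by ring.
    by rewrite e mulr0.
  have -> : c + c * a = c * (a + 1) by ring.
  by rewrite e mulr0.
have b10 : a ^+ 2 + 1 != 0.
  by apply: contraNneq x00 => e; rewrite x0E e mulr0 expr0n oppr0.
pose g := z * c ^+ 2; have g0 : g != 0 by rewrite mulf_neq0 ?expf_neq0.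
have F1 : x0 * (x0 + y0 ^+ 2 + y0 * g) = - g ^+ 4.
  apply: (mulfI c0); transitivity (x0 * A0); first by rewrite a0 a2 /g; ring.
  by rewrite a9 /g; ring.
have F2 : x0 * (x0 + y0 ^+ 2 + y0 * g * a ^+ 2) = - (g ^+ 4 * a ^+ 8).
  apply: (mulfI b40); transitivity (x0 * B0); first by rewrite b0 b2 /g; ring.
  by rewrite b9 /g; ring.
have [xy _] := normal_form_roots h3 g0 a1 x00 F1 F2.
(* The substitution of [al *: 'X] normalizes [z * c ^+ 2] to [- (a ^+ 2 + 1)]. *)
have [al al2] := closed_pow (- g / (a ^+ 2 + 1)) (isT : (0 < 2)%N).
have gE : g = - (al ^+ 2 * (a ^+ 2 + 1)) by rewrite al2 mulfVK ?opprK.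
have al0 : al != 0 by apply: contraNneq g0 => e; rewrite gE e expr0n mul0r oppr0.
have zE : z * c ^+ 2 = - (al ^+ 2 * (a ^+ 2 + 1)) := gE.
have {}x0E : x0 = - (al ^+ 4 * (a ^+ 2 + 1) ^+ 4) by rewrite x0E zE; ring.
have y0E : y0 = - (al ^+ 2 * (a ^+ 4 + 1)).
  by apply: (mulfI x00); rewrite xy gE x0E; ring.
have A0E : A0 = c * al ^+ 4.
  apply: (mulfI x00); transitivity (- (z * c ^+ 2) ^+ 4 * c); first by rewrite a9; ring.
  by rewrite zE x0E; ring.
have B0E : B0 = c * al ^+ 4 * a ^+ 9.
  apply: (mulfI x00); transitivity (- (z * c ^+ 2) ^+ 4 * c * a ^+ 9); first by rewrite b9; ring.
  by rewrite zE x0E; ring.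
have A2E : A2 = - (c * al ^+ 2 * (a ^+ 4 + a ^+ 2 - 1)).
  transitivity (c * (y0 + z * c ^+ 2)); first by rewrite a2; ring.
  by rewrite zE y0E; ring3 h3.
have B2E : B2 = c * al ^+ 2 * a * (a ^+ 4 - a ^+ 2 - 1).
  transitivity (c * a * (y0 + z * c ^+ 2 * a ^+ 2)); first by rewrite b2; ring.
  by rewrite zE y0E; ring3 h3.
exists al, (c * al ^+ 4); split=> //.
- by rewrite mulf_neq0 ?expf_neq0.
- rewrite eA A2E A0E /Q1 !(comp_polyD, comp_polyM, comp_polyC, comp_Xn_poly, comp_polyX).
  by rewrite -!mul_polyC; ring.
- rewrite eB B2E B0E /Q2 !(comp_polyD, comp_polyM, comp_polyC, comp_Xn_poly, comp_polyX).
  by rewrite -!mul_polyC; ring.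
case=> -[[|[|[|i]]] lti] // e.
- by move/eqP: e; rewrite expf_eq0 /= (negPf a_neq0).
- by move: a1; rewrite e eqxx.
- by move: b10; rewrite e /= natr1 h3 eqxx.
Qed.

(** Adding [A] to [B] keeps [x0], [y0], [z] and replaces [a] by [a + 1], so the root taken by [x0]
    tells how often to add [A]. *)
Lemma good_pair_normal_form A B : good_pair A B -> A`_3 = 0 -> B`_3 = 0 ->
  exists B' : {poly k}, [\/ B' = B, B' = B + A | B' = B + A + A] /\
    exists a alpha c, [/\ alpha != 0, c != 0, A \Po (alpha *: 'X) = c *: Q1 a,
      B' \Po (alpha *: 'X) = c *: Q2 a & ~ in_prime_field 3 (a ^+ 2)].
Proof.
move=> gAB a3 b3.
have [x0 [y0 [z [z0 x00 rA rB]]]] := good_pair_reduced gAB a3 b3.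
have gAB1 := good_pairDr h3 gAB; have rB1 := reducedD rB rA.
have gAB2 := good_pairDr h3 gAB1; have rB2 := reducedD rB1 rA.
have [a40 b40 s0 d0] := good_pair_lead gAB.
have e1 : (B + A)`_4 / A`_4 = B`_4 / A`_4 + 1 by rewrite coefD mulrDl divff.
have e2 : (B + A + A)`_4 / A`_4 = B`_4 / A`_4 + 1 + 1 by rewrite coefD mulrDl divff ?e1.
pose a := B`_4 / A`_4; pose g := z * A`_4 ^+ 2.
have [| | | |_ x0E] := @normal_form_roots k a g x0 y0 h3 _ _ x00.
- by rewrite mulf_neq0 ?expf_neq0.
- have b4E : B`_4 = a * A`_4 by rewrite mulfVK.
  rewrite b4E in s0 d0; apply/eqP => e.
  suff /eqP : (A`_4 + a * A`_4) * (A`_4 - a * A`_4) = 0.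
    by rewrite mulf_eq0 (negPf s0) (negPf d0).
  by transitivity (A`_4 ^+ 2 * (1 - a ^+ 2)); [ring | rewrite e subrr mulr0].
- have [_ [A2 A0 A9]] := rA; apply: (mulfI a40).
  transitivity (x0 * A`_0); first by rewrite A0 A2 /g; ring.
  by rewrite A9 /g; ring.
- have [_ [B2 B0 B9]] := rB; have b4E : B`_4 = a * A`_4 by rewrite mulfVK.
  apply: (mulfI b40); transitivity (x0 * B`_0); first by rewrite B0 B2 /g b4E; ring.
  by rewrite B9 /g b4E; ring.
case: x0E => x0E; [exists B | exists (B + A) | exists (B + A + A)];
  (split; first by [apply: Or31 | apply: Or32 | apply: Or33]).
- exists (B`_4 / A`_4); exact: reduced_normal_form gAB z0 x00 rA rB x0E.
- exists ((B + A)`_4 / A`_4); apply: reduced_normal_form gAB1 z0 x00 rA rB1 _.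
  by rewrite e1.
- exists ((B + A + A)`_4 / A`_4); apply: reduced_normal_form gAB2 z0 x00 rA rB2 _.
  by rewrite e2.
Qed.

End NormalForm.

(** * Changes of basis of a span and affine pullback *)

Section AffineChange.
Variable k : closedFieldType.
Hypothesis h3 : 3 = 0 :> k.
Implicit Types (f : ratfun k) (A B P : {poly k}).
Let p3 : 3 = 0 :> {poly k} := poly3_eq0 h3.

Definition span2 (w1 w2 f : ratfun k) := exists i j : 'F_3, f = w1 *+ i + w2 *+ j.

Lemma mulrn_mod3 f n : f *+ (n %% 3) = f *+ n.
Proof.
rewrite [in RHS](divn_eq n 3) mulrnDr mulnC mulrnA.
by rewrite -[f *+ 3]mulr_natl (ratfun3_eq0 h3) mul0r mul0rn add0r.
Qed.

Lemma mulrn_F3D f (i j : 'F_3) : f *+ (i + j)%R = f *+ i + f *+ j.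
Proof. by rewrite -mulrnDr -(mulrn_mod3 f (i + j)). Qed.

Lemma mulrn_F3N f (i : 'F_3) : f *+ (- i)%R = - (f *+ i).
Proof.
apply/eqP; rewrite -addr_eq0 -mulrn_F3D addNr; apply/eqP; exact: mulr0n.
Qed.

Lemma span2B (w1 w2 f : ratfun k) : span2 (w1 - w2) w2 f <-> span2 w1 w2 f.
Proof.
split=> -[i [j ->]].
  exists i, (j - i); rewrite mulrnBl mulrn_F3D mulrn_F3N.
  by rewrite addrAC addrA.
by exists i, (j + i); rewrite mulrnBl mulrn_F3D addrACA [- _ + _]addrC addrA addrK.
Qed.

Lemma span2N (w1 w2 f : ratfun k) : span2 (- w1) (- w2) f <-> span2 w1 w2 f.
Proof.
by split=> -[i [j ->]]; exists (- i), (- j); rewrite !mulNrn !mulrn_F3N ?opprK.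
Qed.

Lemma pform_shear_aux (F : fieldType) (a b : F) : 3 = 0 :> F ->
  a != 0 -> b != 0 -> a + b != 0 -> a - b != 0 ->
  (a * (b + a) ^+ 2 - a ^+ 3)^-1 = (a * b ^+ 2 - a ^+ 3)^-1 - (b * a ^+ 2 - b ^+ 3)^-1.
Proof.
move=> f3 a0 b0 s0 d0.
have -> : a * (b + a) ^+ 2 - a ^+ 3 = - (a * b * (a - b)) by ring3 f3.
have -> : a * b ^+ 2 - a ^+ 3 = - (a * ((a + b) * (a - b))) by ring.
have -> : b * a ^+ 2 - b ^+ 3 = b * ((a + b) * (a - b)) by ring.
by rewrite !invrN; field; rewrite a0 b0 s0 d0.
Qed.

Lemma pform_shear A B : good_pair A B -> pform A (B + A) = pform A B - pform B A.
Proof.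
case=> sA sB sD sS _.
have nz P : size P = 5 -> P%:F != 0 :> ratfun k.
  by move=> s; rewrite tofrac_neq0 // -size_poly_eq0 s.
have E P Q : (P * Q ^+ 2 - P ^+ 3)%:F = P%:F * Q%:F ^+ 2 - P%:F ^+ 3 :> ratfun k.
  by rewrite tofracB (tofracM P) !tofracXn.
have s0 := nz _ sD; have d0 := nz _ sS; rewrite tofracD in s0; rewrite tofracB in d0.
have := pform_shear_aux (ratfun3_eq0 h3) (nz _ sA) (nz _ sB) s0 d0.
by rewrite -tofracD -!E.
Qed.

(** Cubing being additive, [pform (B + A) A = pform B A], and the other generator only changes by
    subtracting this one. *)
Lemma pspan_shear A B f : good_pair A B -> pspan A (B + A) f <-> pspan A B f.
Proof.
move=> gAB.
have e : pform (B + A) A = pform B A by congr (_%:F)^-1; ring3 p3.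
rewrite /pspan e (pform_shear gAB); exact: span2B.
Qed.

Definition affine (alpha beta : k) : {poly k} := alpha *: 'X + beta%:P.

Lemma size_affine alpha beta : alpha != 0 -> size (affine alpha beta) = 2.
Proof.
by move=> a0; rewrite /affine -mul_polyC size_MXaddC polyC_eq0 (negPf a0) size_polyC a0.
Qed.

Lemma deriv_affine alpha beta : (affine alpha beta)^`() = alpha%:P.
Proof. by rewrite derivD derivC addr0 derivZ derivX alg_polyC. Qed.

Lemma deriv2_affine P alpha beta :
  (P \Po affine alpha beta)^`()^`() = (alpha ^+ 2) *: (P^`()^`() \Po affine alpha beta).
Proof.
rewrite deriv_comp derivM deriv_comp deriv_affine derivC mulr0 addr0.
by rewrite -mul_polyC; ring.
Qed.

Lemma bez_affine A B alpha beta (q := affine alpha beta) :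
  bez (A \Po q) (B \Po q) = (alpha ^+ 2) *: (bez A B \Po q).
Proof.
rewrite /bez -!(rmorphXn (comp_poly q)) -!comp_polyM !deriv2_affine.
by rewrite -!mul_polyC comp_polyD !comp_polyM; ring.
Qed.

Lemma bezZ (e : k) A B : bez (e *: A) (e *: B) = (e ^+ 6) *: bez A B.
Proof.
rewrite /bez.
have -> : e *: A * (e *: B) ^+ 2 = (e ^+ 3) *: (A * B ^+ 2) by rewrite -!mul_polyC; ring.
have -> : (e *: A) ^+ 2 * (e *: B) = (e ^+ 3) *: (A ^+ 2 * B) by rewrite -!mul_polyC; ring.
by rewrite !derivZ -!mul_polyC; ring.
Qed.

(** [bez] is scaled by [alpha ^+ 2] through the two derivatives and by [e ^+ 6] through homogeneity;
    the choice of [e] makes the product 1. *)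
Lemma good_pair_affine A B alpha beta e (q := affine alpha beta) :
  good_pair A B -> alpha != 0 -> e ^+ 3 = alpha^-1 ->
  good_pair (e *: (A \Po q)) (e *: (B \Po q)).
Proof.
move=> [sA sB sD sS eb] a0 e3.
have e0 : e != 0.
  by apply: contraNneq (invr_neq0 a0) => e0; rewrite -e3 e0 expr0n.
have sz P : size (e *: (P \Po q)) = size P.
  by rewrite size_scale // size_comp_poly2 // size_affine.
split; rewrite -?scalerDr -?scalerBr -?comp_polyD -?comp_polyB ?sz //.
rewrite bezZ bez_affine eb scalerA -[-1]/(- 1%:P) -polyCN comp_polyC.
have -> : e ^+ 6 * alpha ^+ 2 = 1.
  by rewrite -[6%N]/(3 * 2)%N exprM e3 exprVn mulVf // expf_neq0.
by rewrite scale1r polyCN.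
Qed.

Lemma reval_poly P Q : reval P Q%:F = (P \Po Q)%:F.
Proof.
rewrite revalE comp_polyE rmorph_sum /=; apply: eq_bigr => i _.
by rewrite -mul_polyC tofracM tofracXn.
Qed.

Lemma comp_affine_neq0 P alpha beta :
  alpha != 0 -> P != 0 -> P \Po affine alpha beta != 0.
Proof.
by move=> a0 P0; rewrite -size_poly_eq0 size_comp_poly2 ?size_affine // size_poly_eq0.
Qed.

Lemma affine_pullback_frac alpha beta P Q (q := affine alpha beta) :
  alpha != 0 -> Q != 0 ->
  affine_pullback alpha beta (P%:F / Q%:F) = (P \Po q)%:F / (Q \Po q)%:F * (alpha%:P)%:F.
Proof.
move=> a0 Q0; rewrite /affine_pullback rsubstE //; first by rewrite !reval_poly.
by move=> R R0; rewrite reval_poly tofrac_neq0 // comp_affine_neq0.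
Qed.

Lemma affine_pullbackD alpha beta f g : alpha != 0 ->
  affine_pullback alpha beta (f + g) =
  affine_pullback alpha beta f + affine_pullback alpha beta g.
Proof.
move=> a0; rewrite (ratfunE f) (ratfunE g).
move: (rnum f) (rden f) (rden_neq0 f) (rnum g) (rden g) (rden_neq0 g) => N D D0 N' D' D'0.
rewrite (addf_div _ _ (tofrac_neq0 D0) (tofrac_neq0 D'0)) -!tofracM -tofracD.
rewrite !affine_pullback_frac ?mulf_neq0 // -mulrDl; congr (_ * _).
rewrite (addf_div _ _ (tofrac_neq0 (comp_affine_neq0 beta a0 D0))
  (tofrac_neq0 (comp_affine_neq0 beta a0 D'0))) -!tofracM -tofracD.
by rewrite comp_polyD !comp_polyM.
Qed.

Lemma affine_pullback0 alpha beta : alpha != 0 -> affine_pullback alpha beta 0 = 0 :> ratfun k.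
Proof.
move=> a0; apply: (addrI (affine_pullback alpha beta 0)).
by rewrite -affine_pullbackD // !addr0.
Qed.

Lemma affine_pullbackMn alpha beta f n : alpha != 0 ->
  affine_pullback alpha beta (f *+ n) = affine_pullback alpha beta f *+ n.
Proof.
move=> a0; elim: n => [|n IH]; first by rewrite !mulr0n affine_pullback0.
by rewrite !mulrS affine_pullbackD // IH.
Qed.

(** The scalar [e] divides the cubic denominator by [alpha], which accounts for the factor in
    [d(alpha X + beta)]. *)
Lemma affine_pullback_pform alpha beta e A B (q := affine alpha beta) :
  good_pair A B -> alpha != 0 -> e ^+ 3 = alpha^-1 ->
  affine_pullback alpha beta (pform A B) = pform (e *: (A \Po q)) (e *: (B \Po q)).
Proof.
move=> gAB a0 e3; rewrite /pform.
have P0 : A * B ^+ 2 - A ^+ 3 != 0 by rewrite -size_poly_eq0 size_good_pair.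
have -> : e *: (A \Po q) * (e *: (B \Po q)) ^+ 2 - (e *: (A \Po q)) ^+ 3
    = (alpha^-1)%:P * ((A * B ^+ 2 - A ^+ 3) \Po q).
  rewrite comp_polyB comp_polyM !(rmorphXn (comp_poly q)) /= -e3 polyC_exp -!mul_polyC.
  by ring.
move: (A * B ^+ 2 - A ^+ 3) P0 => P P0.
rewrite -[X in affine_pullback _ _ X]mul1r -tofrac1 affine_pullback_frac // comp_polyC tofrac1 mul1r.
rewrite tofracM invfM mulrC; congr (_ * _).
have ai0 : ((alpha^-1)%:P)%:F != 0 :> ratfun k by rewrite tofrac_neq0 // polyC_eq0 invr_eq0.
by apply: (mulIf ai0); rewrite (mulVf ai0) -tofracM -polyCM divff.
Qed.

Lemma affine_pullback_pspan alpha beta e A B f (q := affine alpha beta) :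
  good_pair A B -> alpha != 0 -> e ^+ 3 = alpha^-1 ->
  (pspan (e *: (A \Po q)) (e *: (B \Po q)) f <->
   exists g, pspan A B g /\ f = affine_pullback alpha beta g).
Proof.
move=> gAB a0 e3.
have E i j : affine_pullback alpha beta (pform A B *+ i + pform B A *+ j) =
    pform (e *: (A \Po q)) (e *: (B \Po q)) *+ i + pform (e *: (B \Po q)) (e *: (A \Po q)) *+ j.
  rewrite affine_pullbackD // !affine_pullbackMn //.
  by rewrite !(@affine_pullback_pform _ _ e) //; apply: good_pairC.
split=> [[i [j ->]]|[g [[i [j ->]] ->]]].
  by exists (pform A B *+ i + pform B A *+ j); rewrite E; split=> //; exists i, j.
by exists i, j; rewrite E.
Qed.

End AffineChange.

(** * The pairs [(Q1 a, Q2 a)] and the spaces they generate *)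

Section Family.
Variable k : closedFieldType.
Hypothesis h3 : 3 = 0 :> k.
Implicit Types (a c : k).

Lemma not_prime_field a : ~ in_prime_field 3 (a ^+ 2) ->
  [/\ a != 0, a ^+ 2 != 1 & a ^+ 2 + 1 != 0].
Proof.
move=> H; split; apply/eqP => e; apply: H.
- by exists 0; rewrite e expr0n.
- by exists 1; rewrite e.
- exists 2; have -> : nat_of_ord (2%R : 'F_3) = 2%N by [].
  apply/eqP; rewrite -subr_eq0; apply/eqP; rewrite -[RHS]e; ring3 h3.
Qed.

Lemma coef_Q1 a i : (Q1 a)`_i =
  if i == 4 then 1 else if i == 2 then - (a ^+ 4 + a ^+ 2 - 1)
  else if i == 0 then 1 else 0.
Proof.
rewrite /Q1 !coefD coefN coefZ !coefXn coef1.
by case: i => [|[|[|[|[|i]]]]] /=; rewrite ?(mulr1, mulr0, oppr0, addr0, add0r).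
Qed.

Lemma coef_Q2 a i : (Q2 a)`_i =
  if i == 4 then a else if i == 2 then a * (a ^+ 4 - a ^+ 2 - 1)
  else if i == 0 then a ^+ 9 else 0.
Proof.
rewrite /Q2 coefZ !coefD coefZ !coefXn coefC.
by case: i => [|[|[|[|[|i]]]]] /=; rewrite ?(mulr1, mulr0, oppr0, addr0, add0r).
Qed.

Lemma size_Q1_le a : (size (Q1 a) <= 5)%N.
Proof. by apply/leq_sizeP => i; rewrite coef_Q1; case: i => [|[|[|[|[|i]]]]]. Qed.

Lemma size_Q2_le a : (size (Q2 a) <= 5)%N.
Proof. by apply/leq_sizeP => i; rewrite coef_Q2; case: i => [|[|[|[|[|i]]]]]. Qed.

Lemma size5P (P : {poly k}) : (size P <= 5)%N -> P`_4 != 0 -> size P = 5.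
Proof.
move=> s c; apply/eqP; rewrite eqn_leq s ltnNge.
by apply: contra c => /leq_sizeP /(_ 4) ->.
Qed.

Lemma size_Q_comb a (i j : 'F_3) : ~ in_prime_field 3 (a ^+ 2) -> (i, j) != (0, 0) ->
  size (Q1 a *+ i + Q2 a *+ j) = 5.
Proof.
move=> /not_prime_field [a0 a1 _] ij; apply: size5P.
  rewrite (leq_trans (size_polyD _ _)) // geq_max.
  have le5 (P : {poly k}) n : (size P <= 5)%N -> (size (P *+ n)%R <= 5)%N.
    by move=> s; rewrite -scaler_nat (leq_trans (size_scale_leq _ _)).
  by rewrite !le5 ?size_Q1_le ?size_Q2_le.
rewrite coefD !coefMn coef_Q1 coef_Q2 /=.
have two (x : k) : x *+ 2 = - x by rewrite -mulr_natl; ring3 h3.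
have s0 : 1 + a != 0.
  apply: contraNneq a1 => e; apply/eqP.
  by transitivity (1 + (1 + a) * (a - 1)); [ring | rewrite e mul0r addr0].
have d0 : 1 - a != 0.
  apply: contraNneq a1 => e; apply/eqP.
  by transitivity (1 - (1 - a) * (a + 1)); [ring | rewrite e mul0r subr0].
case: i ij => [[|[|[|i]]] lti] //; case: j => [[|[|[|j]]] ltj] //= _;
  rewrite ?mulr0n ?mulr1n ?two ?add0r ?addr0 ?oppr_eq0 ?oner_eq0 //.
- by rewrite -oppr_eq0 opprD opprK.
- by rewrite -opprD oppr_eq0.
Qed.

Lemma bez_Q a : ~ in_prime_field 3 (a ^+ 2) ->
  exists2 N : k, N != 0 & bez (Q1 a) (Q2 a) = - N%:P.
Proof.
move=> /not_prime_field [a0 a1 b0].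
(* These are the values of [z], [y0] and the minor [D42] when this pair is written in reduced
   form. *)
pose g := - (a ^+ 2 + 1); pose y := - (a ^+ 4 + 1); pose D := a * (1 - a ^+ 4).
pose t := bez_pair (Q1 a) (Q2 a).
have a2E : - (a ^+ 4 + a ^+ 2 - 1) = y + g by rewrite /y /g; ring3 h3.
have b2E : a * (a ^+ 4 - a ^+ 2 - 1) = a * y + g * a ^+ 3 by rewrite /y /g; ring3 h3.
have s1 := size_Q1_le a; have s2 := size_Q2_le a.
have tE i (p := (Q1 a)`_i) (r := (Q2 a)`_i) :
  [/\ t i 11 = 0, t i 8 = D * g * (p ^+ 3 * a ^+ 3 - r ^+ 3), t i 5 = 0
    & t i 2 = g ^+ 4 * D * (p ^+ 3 * a ^+ 9 - r ^+ 3)].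
  rewrite /t /bez_pair !coef_cubic // -/p -/r /cubic_coef !coef_Q1 !coef_Q2 /=.
  move: (p ^+ 3) (r ^+ 3) => p3 r3; rewrite /D /g; split; ring3 h3.
have cB (x y' : k) : (x - y') ^+ 3 = x ^+ 3 - y' ^+ 3 by ring3 h3.
(* This identity is what makes the coefficient of [X^6] vanish. *)
have yg : g * y * (a - a ^+ 3) = a - a ^+ 9 by rewrite /g /y; ring.
exists (t 0 2).
  have [_ _ _ ->] := tE 0; rewrite coef_Q1 coef_Q2 /=.
  have -> : g ^+ 4 * D * (1 ^+ 3 * a ^+ 9 - (a ^+ 9) ^+ 3)
     = g ^+ 4 * D * (a - a ^+ 3) ^+ 9.
    by rewrite [(a - _) ^+ 9](exprM _ 3 3) !cB; ring.
  have -> : D = a * - (a ^+ 2 - 1) * (a ^+ 2 + 1) by rewrite /D; ring.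
  have -> : a - a ^+ 3 = a * - (a ^+ 2 - 1) by ring.
  by rewrite !mulf_neq0 ?expf_neq0 ?mulf_neq0 ?oppr_eq0 ?subr_eq0.
rewrite bez_expand // -/t.
have [z4 f48 z45 f42] := tE 4; have [z3 f38 z35 f32] := tE 3.
have [z2 f28 z25 f22] := tE 2; have [z1 f18 z15 f12] := tE 1; have [z0 f08 z05 _] := tE 0.
rewrite !coef_Q1 !coef_Q2 /= in f48 f42 f38 f32 f28 f22 f18 f12 f08.
rewrite a2E b2E !cubeD // !exprMn in f28 f22.
have E6 : t 4 8 + t 3 11 = 0 by rewrite f48 z3; ring.
have E5 : t 4 5 + t 3 8 + t 2 11 = 0 by rewrite z45 f38 z2; ring.
have E4 : t 4 2 + t 3 5 + t 2 8 + t 1 11 = 0 by rewrite f42 z35 f28 z1; ring.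
have E3 : t 3 2 + t 2 5 + t 1 8 + t 0 11 = 0 by rewrite f32 z25 f18 z0; ring.
have E2 : t 2 2 + t 1 5 + t 0 8 = 0.
  rewrite f22 z15 f08.
  transitivity (D * g * ((a - a ^+ 9) ^+ 3 - (g * y * (a - a ^+ 3)) ^+ 3)); last first.
    by rewrite yg subrr mulr0.
  by rewrite !exprMn !cB; ring.
have E1 : t 1 2 + t 0 5 = 0 by rewrite f12 z05; ring.
by rewrite z4 E6 E5 E4 E3 E2 E1 !polyC0 !mul0r !add0r.
Qed.

Lemma good_pair_Q a : ~ in_prime_field 3 (a ^+ 2) ->
  exists c, good_pair (c *: Q1 a) (c *: Q2 a).
Proof.
move=> ha; have [N N0 bE] := bez_Q ha.
(* [bez] is homogeneous of degree 6, so a sixth root rescales its value to -1. *)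
have [c c6] := closed_pow (N^-1) (isT : (0 < 6)%N).
have c0 : c != 0 by apply: contraNneq (invr_neq0 N0) => e; rewrite -c6 e expr0n.
exists c; have sz i j := @size_Q_comb a i j ha.
split; rewrite -?scalerDr -?scalerBr ?(size_scale _ c0).
- by have := sz 1 0 isT; rewrite mulr0n addr0.
- by have := sz 0 1 isT; rewrite mulr0n add0r.
- exact: (sz 1 1 isT).
- have := sz 1 (-1) isT; rewrite (_ : (-1 : 'F_3) = 2 :> nat) //.
  have -> : Q2 a *+ 2 = - Q2 a by rewrite -mulr_natl; ring3 (poly3_eq0 h3).
  by [].
by rewrite bezZ bE c6 -mul_polyC -polyCN -polyCM mulrN mulVf // polyCN.
Qed.

Lemma pformZ c (A B : {poly k}) : pform (c *: A) (c *: B) = prompt_form 3 c A B.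
Proof. by rewrite /pform /prompt_form; congr (_%:F)^-1; rewrite -!mul_polyC; ring. Qed.

(** Goodness fixes [c ^+ 6], and in characteristic 3 this leaves only [c] and [- c]; the sign merely
    negates both generators. *)
Lemma pspanZ_unique c c' (A B : {poly k}) f :
  good_pair (c *: A) (c *: B) -> good_pair (c' *: A) (c' *: B) ->
  pspan (c *: A) (c *: B) f -> pspan (c' *: A) (c' *: B) f.
Proof.
case=> [_ _ _ _ e] [_ _ _ _ e'].
have c6 : c ^+ 6 = c' ^+ 6.
  have b0 : bez A B != 0.
    apply/eqP => b0; move/eqP: e; rewrite bezZ b0 scaler0 eq_sym oppr_eq0 oner_eq0 //.
  apply/eqP; rewrite -subr_eq0 -(inj_eq (@polyC_inj _)) polyC0 -(inj_eq (mulIf b0)) mul0r.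
  by rewrite mul_polyC scalerBl -!bezZ e e' subrr.
have : c' = c \/ c' = - c.
  have /eqP : (c' - c) ^+ 3 * (c' + c) ^+ 3 = 0.
    by transitivity (c' ^+ 6 - c ^+ 6); [ring3 h3 | rewrite c6 subrr].
  rewrite mulf_eq0 !expf_eq0 /= subr_eq0 addr_eq0 => /orP[] /eqP ->; first by left.
  by right.
case=> -> //; rewrite /pspan !scaleNr !pformNl.
have pr (P Q : {poly k}) : pform P (- Q) = pform P Q by rewrite /pform sqrrN.
by rewrite !pr => H; apply/(span2N h3).
Qed.

(** Ranging over all admissible [c] avoids choosing one; the span does not depend on it. *)
Definition Omega_Q a (f : ratfun k) := exists c,
  good_pair (c *: Q1 a) (c *: Q2 a) /\ pspan (c *: Q1 a) (c *: Q2 a) f.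

Lemma Omega_QE a c f : good_pair (c *: Q1 a) (c *: Q2 a) ->
  Omega_Q a f <-> pspan (c *: Q1 a) (c *: Q2 a) f.
Proof.
move=> g; split=> [[c' [g']]|]; first exact: pspanZ_unique.
by exists c.
Qed.

Lemma Omega_Q_prompt a : ~ in_prime_field 3 (a ^+ 2) ->
  spaceL 3 11 2 (Omega_Q a) /\ prompt 3 (Q1 a) (Q2 a) (Omega_Q a).
Proof.
move=> ha; have [c g] := good_pair_Q ha; have E f := Omega_QE f g.
have [bspan bfree] := good_Fp_basis h3 g.
have basis : Fp_basis 3 (pair_fun (pform (c *: Q1 a) (c *: Q2 a))
    (pform (c *: Q2 a) (c *: Q1 a))) (Omega_Q a).
  by split=> // f; rewrite E.
split.
  split; first by exists (pair_fun (pform (c *: Q1 a) (c *: Q2 a)) (pform (c *: Q2 a) (c *: Q1 a))).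
  by have [_ H] := good_spaceL h3 g; move=> f /E; apply: H.
have sz i j := @size_Q_comb a i j ha; split.
  exists 4; split.
  - by have := sz 1 0 isT; rewrite mulr0n addr0.
  - by have := sz 0 1 isT; rewrite mulr0n add0r.
  - exact: sz.
exists c; split; last by move: basis; rewrite !pformZ.
apply/eqP => c0; case: g => s _ _ _ _.
by move: s; rewrite c0 scale0r size_poly0.
Qed.

End Family.

(** * Centring, normalization and classification *)

Lemma coef3_translate (k : closedFieldType) (P : {poly k}) (beta : k) :
  3 = 0 :> k -> (size P <= 5)%N ->
  (P \Po affine 1 beta)`_3 = P`_3 + P`_4 * beta.
Proof.
move=> h3 s; rewrite {1}(poly5E s) /affine scale1r.
rewrite !(comp_polyD, comp_polyM, comp_polyC, comp_Xn_poly, comp_polyX).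
move: (P`_4) (P`_3) (P`_2) (P`_1) (P`_0) => p4 p3 p2 p1 p0.
have -> : p4%:P * ('X + beta%:P) ^+ 4 + p3%:P * ('X + beta%:P) ^+ 3
    + p2%:P * ('X + beta%:P) ^+ 2 + p1%:P * ('X + beta%:P) + p0%:P
  = p4%:P * 'X^4 + (p3 + 4 * p4 * beta)%:P * 'X^3
    + (6 * p4 * beta ^+ 2 + 3 * p3 * beta + p2)%:P * 'X^2
    + (4 * p4 * beta ^+ 3 + 3 * p3 * beta ^+ 2 + 2 * p2 * beta + p1)%:P * 'X
    + (p4 * beta ^+ 4 + p3 * beta ^+ 3 + p2 * beta ^+ 2 + p1 * beta + p0)%:P by ring.
rewrite !coefD !coefCM !coefXn coefX coefC /= !(mulr1, mulr0, addr0, add0r).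
ring3 h3.
Qed.

Lemma good_pair_normalize (k : closedFieldType) (A B : {poly k}) :
  3 = 0 :> k -> good_pair A B ->
  exists B', [/\ good_pair A B', forall f, pspan A B' f <-> pspan A B f &
    exists a alpha beta c, [/\ alpha != 0, ~ in_prime_field 3 (a ^+ 2),
      A \Po affine alpha beta = c *: Q1 a & B' \Po affine alpha beta = c *: Q2 a]].
Proof.
move=> h3 gAB; have [a40 _ _ _] := good_pair_lead gAB.
(* As [4 = 1], this translation kills the cubic coefficient of [A], and that of [B] as well since
   the cubic and leading coefficient vectors are parallel. *)
pose beta := - A`_3 / A`_4; pose q := affine 1 beta.
have [sA sB _ _ _] := gAB.
have gq : good_pair (A \Po q) (B \Po q).
  have one3 : (1 : k) ^+ 3 = 1^-1 by rewrite expr1n invr1.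
  by have := good_pair_affine beta gAB (oner_neq0 k) one3; rewrite !scale1r.
have a3 : (A \Po q)`_3 = 0.
  by rewrite coef3_translate ?sA // /beta mulrC mulfVK // subrr.
have b3 : (B \Po q)`_3 = 0.
  rewrite coef3_translate ?sB //; apply: (mulfI a40); rewrite mulr0 mulrDr.
  rewrite -(good_pair_coef3 h3 gAB) /beta.
  by field.
have qal (alpha : k) P : (P \Po q) \Po (alpha *: 'X) = P \Po affine alpha beta.
  rewrite -comp_polyA /q /affine scale1r comp_polyD comp_polyX comp_polyC //.
have [B0 [B0E [a [alpha [c [al0 c0 eA eB ha]]]]]] := good_pair_normal_form h3 gq a3 b3.
have gAB1 := good_pairDr h3 gAB; have gAB2 := good_pairDr h3 gAB1.
have fin B' : good_pair A B' -> (forall f, pspan A B' f <-> pspan A B f) ->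
    B0 = B' \Po q -> exists B', [/\ good_pair A B', forall f, pspan A B' f <-> pspan A B f &
    exists a alpha beta c, [/\ alpha != 0, ~ in_prime_field 3 (a ^+ 2),
      A \Po affine alpha beta = c *: Q1 a & B' \Po affine alpha beta = c *: Q2 a]].
  move=> gB' spB' eB0; exists B'; split=> //.
  by exists a, alpha, beta, c; split=> //; rewrite -qal // -eB0.
(* The shear found for the centred pair is applied to the original pair, whose span it preserves. *)
case: B0E => eB0.
- exact: fin gAB _ eB0.
- apply: fin gAB1 _ _; first by move=> f; apply: pspan_shear.
  by rewrite comp_polyD.
- apply: fin gAB2 _ _; last by rewrite !comp_polyD.
  by move=> f; rewrite (pspan_shear h3 f gAB1); apply: pspan_shear.
Qed.

Theorem theorem6p1 (k : closedFieldType) (pchar3 : 3%N \in [pchar k]) :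
  exists Omega_ : k -> ratfun k -> Prop,
    (forall a : k, ~ in_prime_field 3 (a ^+ 2) ->
       spaceL 3 11 2 (Omega_ a) /\ prompt 3 (Q1 a) (Q2 a) (Omega_ a)) /\
    (forall Omega : ratfun k -> Prop, spaceL 3 11 2 Omega ->
       exists a : k, ~ in_prime_field 3 (a ^+ 2) /\
         equivalent_spaces Omega (Omega_ a)).
Proof.
have h3 : 3 = 0 :> k := pcharf0 pchar3.
exists (@Omega_Q k); split; first by move=> a; apply: Omega_Q_prompt.
move=> Omega /(spaceL_good h3) [A [B [gAB OE]]].
have [B' [gAB' spanB' [a [alpha [beta [c [al0 ha eA eB]]]]]]] := good_pair_normalize h3 gAB.
(* The cube root [e] makes the pulled back pair good, hence an admissible multiple of
   [(Q1 a, Q2 a)]. *)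
have [e e3] := closed_pow alpha^-1 (isT : (0 < 3)%N).
have g := good_pair_affine beta gAB' al0 e3.
rewrite eA eB (scalerA e c (Q1 a)) (scalerA e c (Q2 a)) in g.
exists a; split=> //; exists alpha, beta; split=> // f.
rewrite (Omega_QE h3 f g) -(scalerA e c (Q1 a)) -(scalerA e c (Q2 a)) -eA -eB.
rewrite (affine_pullback_pspan beta f gAB' al0 e3).
by split=> -[h [Hh ->]]; exists h; split=> //; [apply/OE/spanB' | apply/spanB'/OE].
Qed.
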